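(* Let $p$ be a prime with $p\neq 2,3,11$. If $p\equiv 3\pmod 4$, then $$\sum_{k=0}^{p-1}\frac{\binom{2k}{k}\binom{3k}{k}\binom{6k}{3k}}{66^{3k}}\equiv 0\pmod{p^2}.$$ If $p\equiv 1\pmod 4$ and so $p=a^2+b^2$ with $a,b\in\mathbb{Z}$ and $2\nmid a$, then $$\sum_{k=0}^{p-1}\frac{\binom{2k}{k}\binom{3k}{k}\binom{6k}{3k}}{66^{3k}}\equiv \left(\frac{p}{33}\right)4a^2\pmod p.$$
   Context: $\left(\frac{p}{33}\right)$ denotes the Jacobi symbol. Congruences modulo $p$ and $p^2$ are in the ring of rational numbers whose denominator is coprime to $p$. *)

(* Defs.v *)
From mathcomp Require Import all_boot all_order all_algebra.
Set Implicit Arguments.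
Unset Strict Implicit.
Unset Printing Implicit Defensive.

Import Order.TTheory GRing.Theory Num.Theory.
Local Open Scope ring_scope.

(* Meaningful only when [q] is an odd prime. *)
Definition legendre (a : int) (q : nat) : int :=
  if (q%:Z %| a)%Z then 0
  else if [exists x : 'I_q, ((x%:Z) ^+ 2 == a %[mod q%:Z])%Z] then 1 else -1.

(* [prime_decomp n] lists the pairs (prime, exponent) in the factorization of
   [n]; meaningful only when [n] is odd and positive. *)
Definition jacobi (a : int) (n : nat) : int :=
  \prod_(f <- prime_decomp n) legendre a f.1 ^+ f.2.

Definition pintegral (p : nat) (x : rat) : bool := coprimez p%:Z (denq x).

(* Congruence modulo the ideal generated by [m] in the ring of [p]-integral
   rationals; both sides are required to belong to that ring. *)
Definition eqmod_pint (p m : nat) (x y : rat) : Prop :=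
  [/\ pintegral p x, pintegral p y &
      exists2 z : rat, pintegral p z & x - y = m%:R * z].

Definition binom_sum (p : nat) : rat :=
  \sum_(0 <= k < p)
    (('C(2 * k, k) * 'C(3 * k, k) * 'C(6 * k, 3 * k))%N%:R / 66%:R ^+ (3 * k)).

(* Main.v *)
Require Import Defs.
From mathcomp Require Import all_boot all_order all_algebra.
From mathcomp Require Import all_fingroup all_solvable all_field.
From mathcomp Require Import ring zify.
Import Order.TTheory GRing.Theory Num.Theory.
Local Open Scope ring_scope.

(** Write B_k = C(3k,k) C(6k,3k), A_k = C(2k,k) B_k, let f and G be the
generating polynomials of the B_k and the A_k with k < p, and put
m = (p-1)/2.

Clausen's identity says that the untruncated series satisfy
f(x)^2 = G(x (1 - 432 x)).  The truncated ones satisfy it modulo p^2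
([clausen_mod]): below degree p nothing is lost, and from degree p on every
contribution to either side is divisible by p^2.  Since
1/66^3 = x (1 - 432 x) for x = (121 - 21 sqrt 33) / (121 * 864), the sum of the
theorem is the square of f(x) in the p-integral elements of Q(sqrt 33).

Modulo p the number f(x) is a Hasse invariant ([hasse_sextic]): 3^m f(x) is
the coefficient of X^(p-1) in (X^3 - 3 X + 2 (1 - 864 x))^m.  At this x the
cubic is X^3 - 11 X + 14 rescaled by s = sqrt 33 / 11, so that
3^m f(x) = - s^m S, where S is the sum of the quadratic character over the
values of X^3 - 11 X + 14 ([sextic_eval]).  The curve Y^2 = X^3 - 11 X + 14 is
2-isogenous to the curve Y^2 = X^3 - X with complex multiplication by i, so S
is also the character sum of X^3 - X ([isogeny_sum]).

If p = 3 mod 4, then S = 0, because -1 is not a square and X^3 - X is odd.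
This holds for both square roots of 33, so f(x) = e + o sqrt 33 with e and o
divisible by p, and its square vanishes modulo p^2.

If p = 1 mod 4, Jacobsthal's theorem ([jacobsthal_two_squares]) and the
uniqueness of the representation of p as a sum of two squares give
S^2 = 4 a^2.  The factor s^(2m) = (33 / 121)^m is 33^m modulo p, and
33^m = (p/33) by quadratic reciprocity for 3 and 11, which is read off from
the Gauss sums of orders 3 and 11 ([half_power_33]). *)

(** * The hypergeometric coefficients and their recurrences *)

(** The coefficients of 2F1(1/6, 5/6; 1; 432 x). *)
Definition sextic (k : nat) : nat := ('C(3 * k, k) * 'C(6 * k, 3 * k))%N.

(** The coefficients of 3F2(1/6, 1/2, 5/6; 1, 1; 1728 z), the series whose
relation to the square of the previous one is Clausen's identity. *)
Definition clausen (k : nat) : nat := ('C(2 * k, k) * sextic k)%N.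

(** The binomials telescope to (6k)! / (k! (2k)! (3k)!), the form from which
both the recurrence and the p-adic valuation are read. *)
Lemma sextic_fact k :
  (sextic k * (k`! * (2 * k)`! * (3 * k)`!) = (6 * k)`!)%N.
Proof.
have e1 : (3 * k - k = 2 * k)%N by lia.
have e2 : (6 * k - 3 * k = 3 * k)%N by lia.
have h1 := @bin_fact (3 * k) k ltac:(lia); rewrite e1 in h1.
have h2 := @bin_fact (6 * k) (3 * k) ltac:(lia); rewrite e2 in h2.
transitivity ('C(3 * k, k) * (k`! * (2 * k)`!) * 'C(6 * k, 3 * k) * (3 * k)`!)%N.
  by rewrite /sextic; ring.
rewrite h1 -h2; ring.
Qed.

Lemma sextic_rec k :
  (k.+1 ^ 2 * sextic k.+1 = 12 * (6 * k + 1) * (6 * k + 5) * sextic k)%N.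
Proof.
have h0 := sextic_fact k.
have := sextic_fact k.+1.
have -> : (6 * k.+1 = (6 * k).+4.+2)%N by lia.
have -> : (3 * k.+1 = (3 * k).+3)%N by lia.
have -> : (2 * k.+1 = (2 * k).+2)%N by lia.
rewrite !factS -h0.
have p1 := fact_gt0 k; have p2 := fact_gt0 (2 * k); have p3 := fact_gt0 (3 * k).
set x := k`! in p1 *; set y := (2 * k)`! in p2 *; set z := (3 * k)`! in p3 *.
set u := sextic k.+1; set v := sextic k => h.
apply/eqP; rewrite -(@eqn_pmul2l (x * y * z * (k.+1 * 2 * (2 * k + 1) * 3 * (3 * k + 2) * (3 * k + 1))))%N; last first.
  by rewrite !muln_gt0 p1 p2 p3 /= !addnS.
apply/eqP.
transitivity (u * (k.+1 * x * ((2 * k).+2 * ((2 * k).+1 * y)) *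
     ((3 * k).+3 * ((3 * k).+2 * ((3 * k).+1 * z)))))%N; first by ring.
rewrite h; ring.
Qed.

Lemma central_bin_rec k :
  (k.+1 * 'C(2 * k.+1, k.+1) = 2 * (2 * k + 1) * 'C(2 * k, k))%N.
Proof.
have h0 := @bin_fact (2 * k) k ltac:(lia).
have h1 := @bin_fact (2 * k.+1) k.+1 ltac:(lia).
move: h0 h1; have -> : (2 * k - k = k)%N by lia.
have -> : (2 * k.+1 - k.+1 = k.+1)%N by lia.
have -> : (2 * k.+1 = (2 * k).+2)%N by lia.
rewrite !factS => <-.
have p1 := fact_gt0 k; set x := k`! in p1 * => h.
apply/eqP; rewrite -(@eqn_pmul2l (x * x * k.+1))%N; last by rewrite !muln_gt0 p1.
apply/eqP.
transitivity ('C((2 * k).+2, k.+1) * (k.+1 * x * (k.+1 * x)))%N; first by ring.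
rewrite h; ring.
Qed.

Lemma clausen_rec k :
  (k.+1 ^ 3 * clausen k.+1
   = 24 * (2 * k + 1) * (6 * k + 1) * (6 * k + 5) * clausen k)%N.
Proof.
have h1 := sextic_rec k; have h2 := central_bin_rec k.
rewrite /clausen.
transitivity ((k.+1 * 'C(2 * k.+1, k.+1)) * (k.+1 ^ 2 * sextic k.+1))%N; first by ring.
rewrite h1 h2; ring.
Qed.

(** * Divisibility of the coefficients by p *)

Lemma logn_fact_small p n : prime p -> (n < p ^ 2)%N -> logn p n`! = (n %/ p)%N.
Proof.
move=> pp lt_n; have p_gt0 := prime_gt0 pp.
rewrite logn_fact //; case: n lt_n => [|n] lt_n.
  by rewrite big_geq // div0n.
rewrite big_ltn // expn1 [X in (_ + X)%N]big_nat_cond big1 ?addn0 //.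
move=> i /andP[/andP[i_ge2 _] _].
rewrite divn_small // (leq_trans lt_n) // leq_exp2l //; exact: prime_gt1.
Qed.

Lemma sextic_gt0 k : (0 < sextic k)%N.
Proof. by rewrite /sextic muln_gt0 !bin_gt0; lia. Qed.

(** Legendre's formula for (6k)! / (k! (2k)! (3k)!); as 6k < p^2, only the
first power of p contributes, and floor(k/p) = 0. *)
Lemma logn_sextic p k : prime p -> (5 <= p)%N -> (k < p)%N ->
  (logn p (sextic k) + (2 * k %/ p + 3 * k %/ p) = 6 * k %/ p)%N.
Proof.
move=> pp p5 ltkp.
have lt6 : (6 * k < p ^ 2)%N by rewrite -mulnn; nia.
rewrite -(@logn_fact_small p (6 * k)) // -sextic_fact.
have s_gt0 := sextic_gt0 k; set s := sextic k in s_gt0 *; clearbody s.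
rewrite !lognM ?muln_gt0 ?fact_gt0 ?s_gt0 //.
have [lt1 lt2 lt3] : [/\ k < p ^ 2, 2 * k < p ^ 2 & 3 * k < p ^ 2]%N.
  by split; lia.
by rewrite !logn_fact_small // (divn_small ltkp) add0n.
Qed.

Lemma dvdn_sextic p k : prime p -> (5 <= p)%N -> (k < p)%N ->
  (p <= 6 * k)%N -> (p %| sextic k)%N.
Proof.
move=> pp p5 ltkp le6.
have h := @logn_sextic p k pp p5 ltkp.
rewrite -(expn1 p) pfactor_dvdn ?sextic_gt0 //.
have := ltn_ceil (2 * k) (prime_gt0 pp); have := ltn_ceil (3 * k) (prime_gt0 pp).
have := leq_divM (2 * k) p; have := leq_divM (3 * k) p.
have := ltn_ceil (6 * k) (prime_gt0 pp).
move: h; set a := (2 * k %/ p)%N; set b := (3 * k %/ p)%N; set c := (6 * k %/ p)%N.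
move=> h h1 h2 h3 h4 h5.
have ha : (a < 2)%N by rewrite ltn_divLR; lia.
have hb : (b < 3)%N by rewrite ltn_divLR; lia.
have : (a + b < c)%N; last by lia.
rewrite ltnNge; apply/negP => hc.
case: a ha h h2 h3 h4 h5 hc => [|[|a]] //; case: b hb => [|[|[|b]]] //; nia.
Qed.

Lemma dvdn_sextic_sq p k : prime p -> (5 <= p)%N -> (k < p)%N ->
  (5 * p <= 6 * k)%N -> (p ^ 2 %| sextic k)%N.
Proof.
move=> pp p5 ltkp le6; have p_gt0 := prime_gt0 pp.
have h := @logn_sextic p k pp p5 ltkp.
rewrite pfactor_dvdn ?sextic_gt0 //.
have c5 : (5 <= 6 * k %/ p)%N by rewrite leq_divRL.
have ha : (2 * k %/ p < 2)%N by rewrite ltn_divLR; lia.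
have hb : (3 * k %/ p < 3)%N by rewrite ltn_divLR; lia.
lia.
Qed.

(** If k + l >= p, either one index is at least 5p/6, and its coefficient alone
has valuation 2, or both indices exceed p/6, and each coefficient has
valuation at least 1. *)
Lemma dvdn_sexticM p k l : prime p -> (5 <= p)%N -> (k < p)%N -> (l < p)%N ->
  (p <= k + l)%N -> (p ^ 2 %| sextic k * sextic l)%N.
Proof.
move=> pp p5 ltk ltl le.
have [hk|hk] := leqP (5 * p) (6 * k).
  by apply: dvdn_mulr; apply: dvdn_sextic_sq.
have [hl|hl] := leqP (5 * p) (6 * l).
  by apply: dvdn_mull; apply: dvdn_sextic_sq.
by rewrite -mulnn; apply: dvdn_mul; apply: dvdn_sextic => //; lia.
Qed.

Lemma dvdn_clausen p k : prime p -> (5 <= p)%N -> (k < p)%N ->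
  (p <= 2 * k)%N -> (p ^ 2 %| clausen k)%N.
Proof.
move=> pp p5 ltkp le2; have p_gt0 := prime_gt0 pp.
rewrite -mulnn; apply: dvdn_mul; last by apply: dvdn_sextic => //; lia.
have lek : (k <= 2 * k)%N by lia.
rewrite -(expn1 p) pfactor_dvdn ?bin_gt0 //.
have := congr1 (logn p) (bin_fact lek).
have -> : (2 * k - k = k)%N by lia.
have hp : (2 * k < p ^ 2)%N by nia.
rewrite !lognM ?muln_gt0 ?bin_gt0 ?fact_gt0 ?lek //.
have hk : (k < p ^ 2)%N by lia.
rewrite !logn_fact_small // (divn_small ltkp) !addn0 => ->.
by rewrite divn_gt0.
Qed.

(** * The differential equations, up to truncation *)

Definition clausen_arg : {poly int} := 'X * (1 - 432%:P * 'X).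

(** The symmetric square of the operator u |-> (q u')' - 60 u, where
q = X - 432 X^2: it annihilates u^2 whenever (q u')' = 60 u. *)
Definition sym2 (D : {poly int}) : {poly int} :=
  (clausen_arg * (clausen_arg * D^`())^`())^`() - 240%:P * (clausen_arg * D^`())
  - 120%:P * (clausen_arg^`() * D).

Lemma deriv_clausen_arg : clausen_arg^`() = 1 - 864%:P * 'X.
Proof.
rewrite /clausen_arg !(derivE, derivM, derivB); rewrite -polyC1; ring.
Qed.

Lemma coef_clausen_argM (D : {poly int}) k :
  (clausen_arg * D)`_k.+1 = D`_k - 432 * (if k is k'.+1 then D`_k' else 0).
Proof.
rewrite /clausen_arg -mulrA coefXM /= mulrBl mul1r coefB -mulrA coefCM coefXM.
by case: k.
Qed.

Lemma coef_clausen_arg_deriv (D : {poly int}) k :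
  (clausen_arg * D^`())`_k = D`_k *+ k - 432 * (D`_k.-1 *+ k.-1).
Proof.
case: k => [|k]; first by rewrite /clausen_arg -mulrA coefXM /= !mulr0n mulr0 subr0.
by rewrite coef_clausen_argM coef_deriv; case: k => [|k] /=; rewrite ?mulr0n ?coef_deriv.
Qed.

(** The lowest term d X^k of D, with k > 0, contributes k^3 d X^(k-1), and no
other term of D reaches that degree.  So a power series solution is
determined by its constant term, and the same holds up to a given order. *)
Lemma sym2_low (D : {poly int}) n : D`_0 = 0 ->
  (forall i, (i < n)%N -> (sym2 D)`_i = 0) -> forall i, (i <= n)%N -> D`_i = 0.
Proof.
move=> D0 hL; elim/ltn_ind => -[//|k] IH lekn.
have IH' i : (i <= k)%N -> D`_i = 0.
  by move=> lei; apply: IH; lia.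
have := hL k lekn.
rewrite /sym2 !coefB coef_deriv !coefCM !coef_clausen_arg_deriv /=.
have -> : (clausen_arg^`() * D)`_k = 0.
  rewrite coefM big1 // => i _; rewrite IH' ?mulr0 //; lia.
rewrite (IH' k) // (IH' k.-1); last by lia.
rewrite !(mul0rn, mulr0, subr0) -!mulrnA.
move/eqP; rewrite mulrn_eq0 => /orP[|/eqP //].
by rewrite !muln_eq0.
Qed.

Definition sextic_poly (n : nat) : {poly int} := \poly_(k < n) (sextic k)%:Z.
Definition clausen_poly (n : nat) : {poly int} := \poly_(k < n) (clausen k)%:Z.

(** The hypergeometric equation; truncating the series costs a single term of
top degree. *)
Lemma sextic_ode n :
  exists c : int, (clausen_arg * (sextic_poly n.+1)^`())^`()
    = 60%:P * sextic_poly n.+1 + c *: 'X^n.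
Proof.
exists (- (60 + 432 * (n * n.+1))%:Z * (sextic n)%:Z); apply/polyP => k.
rewrite coef_deriv coef_clausen_arg_deriv /= coefD coefCM coefZ coefXn.
have rec := congr1 Posz (sextic_rec k).
rewrite !coef_poly !ltnS.
case: ltngtP => [lekn|ltnk|->] /=.
- rewrite mulr0 addr0.
  move: rec; set u := sextic k.+1; set v := sextic k => rec.
  transitivity ((k.+1 ^ 2 * u)%:Z - 432 * v%:Z * k%:Z * k.+1%:Z); first by ring.
  rewrite rec; ring.
- ring.
- ring.
Qed.

(** With t = X d/dX and D = d/dX, this is the equation
D ((1 - 1728 X) t^2 - 864 X t) G = (240 t + 120) G, up to a term of top
degree caused by the truncation. *)
Lemma clausen_ode n :
  exists c : int,
  let G := clausen_poly n.+1 in let G1 := 'X * G^`() in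
    ((1 - 1728%:P * 'X) * 'X * G1^`() - 864%:P * ('X * G1))^`()
    = 240%:P * G1 + 120%:P * G + c *: 'X^n.
Proof.
exists (- 24 * ((2 * n + 1) * (6 * n + 1) * (6 * n + 5))%:Z * (clausen n)%:Z).
move=> G G1; apply/polyP => k.
have cG1 i : G1`_i = G`_i *+ i.
  by rewrite /G1 coefXM; case: i => [|i] //=; rewrite coef_deriv.
have cXD (P : {poly int}) i : ('X * P^`())`_i = P`_i *+ i.
  by rewrite coefXM; case: i => [|i] //=; rewrite coef_deriv.
clearbody G1.
rewrite coef_deriv coefB -mulrA mulrBl mul1r coefB -(mulrA 1728%:P) !coefCM.
rewrite cXD coefXM /= cXD coefXM /= !coefD !coefCM !cG1 coefZ coefXn.
have rec := congr1 Posz (clausen_rec k).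
rewrite /G !coef_poly !ltnS.
case: ltngtP => [lekn|ltnk|->] /=.
- rewrite mulr0 addr0.
  move: rec; set u := clausen k.+1; set v := clausen k => rec.
  transitivity ((k.+1 ^ 3 * u)%:Z - 1728 * v%:Z * k%:Z * k%:Z * k.+1%:Z 
   - 864 * v%:Z * k%:Z * k.+1%:Z); first by ring.
  rewrite rec; ring.
- ring.
- ring.
Qed.

(** * Clausen's identity *)

(** With a = u' and (q a)' = 60 u + c X^n one finds
q ((u^2)' q)' = 2 (q a)^2 + 120 q u^2 + 2 c q u X^n; differentiating once more,
everything that does not contain c cancels. *)
Lemma sym2_sextic_low n i : (i < n)%N -> (sym2 (sextic_poly n.+1 ^+ 2))`_i = 0.
Proof.
move=> ltin; have [c hc] := sextic_ode n.
set u := sextic_poly _ in hc *; pose a := u^`(); rewrite -/a in hc.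
have h1 : (u ^+ 2)^`() = 2%:P * (u * a) by rewrite expr2 derivM -/a; ring.
have h2 : (clausen_arg * (2%:P * (u * a)))^`() =
   2%:P * (a * (clausen_arg * a)) + 2%:P * (u * (60%:P * u + c *: 'X^n)).
  rewrite -hc (_ : _ * _ = 2%:P * (u * (clausen_arg * a))); last by ring.
  by rewrite [LHS]derivM derivC mul0r add0r [(u * _)^`()]derivM -/a; ring.
have h3 : clausen_arg * (2%:P * (a * (clausen_arg * a)) + 2%:P * (u * (60%:P * u + c *: 'X^n)))
  = 2%:P * ((clausen_arg * a) * (clausen_arg * a)) + 120%:P * (clausen_arg * (u * u))
    + (2%:P * (c *: 'X^n) * u * (1 - 432%:P * 'X)) * 'X.
  by rewrite /clausen_arg; ring.
have -> : sym2 (u ^+ 2) = 4%:P * (clausen_arg * a * (c *: 'X^n))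
    + ((2%:P * c%:P * u * (1 - 432%:P * 'X)) * 'X^(n.+1))^`().
  rewrite /sym2 h1 h2 h3 derivD.
  rewrite (_ : 2%:P * (c *: 'X^n) * u * (1 - 432%:P * 'X) * 'X = 
             (2%:P * c%:P * u * (1 - 432%:P * 'X)) * 'X^(n.+1)); last first.
    by rewrite -mul_polyC exprS; ring.
  set E := (_ * 'X^(n.+1))^`().
  move: (clausen_arg) hc {h2 h3} => q hc.
  rewrite derivD !(derivM, derivC, mul0r, add0r) -/a.
  have -> : q^`() * a + q * a^`() = 60%:P * u + c *: 'X^n.
    by rewrite -hc derivM.
  ring.
rewrite coefD coefCM -scalerAr coefZ coefMXn ltin !mulr0 add0r.
by rewrite coef_deriv coefMXn ltnS ltin mul0rn.
Qed.

(** Since q'^2 = 1 - 1728 q and q'' = -864, the chain rule turns the operator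
applied to G(q) into q' times the operator of the equation of G, evaluated
at q.  The truncation error is a multiple of q^n, hence of X^n. *)
Lemma sym2_clausen_low n i : (i < n)%N ->
  (sym2 (clausen_poly n.+1 \Po clausen_arg))`_i = 0.
Proof.
move=> ltin; have [c] := clausen_ode n.
set G := clausen_poly _ => /=; set G1 := 'X * G^`() => hc.
have h1 : clausen_arg * (G \Po clausen_arg)^`() = (G1 \Po clausen_arg) * clausen_arg^`().
  by rewrite deriv_comp /G1 comp_polyM comp_polyX mulrA.
have dd : clausen_arg^`()^`() = - 864%:P.
  by rewrite deriv_clausen_arg derivB derivM !derivC derivX; ring.
have d2 : clausen_arg^`() ^+ 2 = 1 - 1728%:P * clausen_arg.
  by rewrite deriv_clausen_arg /clausen_arg; ring.
have h2 : clausen_arg * ((G1 \Po clausen_arg) * clausen_arg^`())^`() =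
  ((1 - 1728%:P * 'X) * 'X * G1^`() - 864%:P * ('X * G1)) \Po clausen_arg.
  have -> : ((G1 \Po clausen_arg) * clausen_arg^`())^`() =
      (G1^`() \Po clausen_arg) * clausen_arg^`() ^+ 2 + (G1 \Po clausen_arg) * clausen_arg^`()^`().
    by rewrite [LHS]derivM deriv_comp expr2 mulrA.
  rewrite dd d2.
  rewrite comp_polyB !comp_polyM comp_polyB !comp_polyM !comp_polyC !comp_polyX.
  ring.
have -> : sym2 (G \Po clausen_arg) = (c *: (1 - 432%:P * 'X) ^+ n * clausen_arg^`()) * 'X^n.
  rewrite /sym2 h1 h2 deriv_comp hc !comp_polyD !comp_polyM !comp_polyC.
  rewrite comp_polyZ rmorphXn /= comp_polyX.
  rewrite [clausen_arg ^+ n]exprMn -!mul_polyC; ring.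
by rewrite coefMXn ltin.
Qed.

(** Clausen's identity up to the order of truncation: both sides have constant
term 1 and are annihilated by the same operator to that order. *)
Lemma clausen_low n i : (i <= n)%N ->
  (sextic_poly n.+1 ^+ 2)`_i = (clausen_poly n.+1 \Po clausen_arg)`_i.
Proof.
move=> lein; apply/eqP; rewrite -subr_eq0 -coefB.
apply/eqP; apply: (@sym2_low _ n) => // [|j ltj].
  rewrite coefB expr2 coef0M -!horner_coef0 horner_comp /clausen_arg !hornerE.
  by rewrite !horner_coef0 !coef_poly.
have -> : sym2 (sextic_poly n.+1 ^+ 2 - (clausen_poly n.+1 \Po clausen_arg)) =
  sym2 (sextic_poly n.+1 ^+ 2) - sym2 (clausen_poly n.+1 \Po clausen_arg).
  by rewrite /sym2 !(derivB, mulrBr); ring.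
by rewrite coefB sym2_sextic_low // sym2_clausen_low // subrr.
Qed.

(** Below degree p the two sides agree exactly.  From degree p on, the products
B_k B_l with k + l >= p on the left and the terms A_k q^k with 2k >= p on the
right are all divisible by p^2. *)
Lemma clausen_mod p : prime p -> (5 <= p)%N ->
  exists R : {poly int},
    sextic_poly p ^+ 2 = (clausen_poly p \Po clausen_arg) + (p ^ 2)%:Z *: R.
Proof.
move=> pp p5; set D := sextic_poly p ^+ 2 - (clausen_poly p \Po clausen_arg).
have dvd i : ((p ^ 2)%:Z %| D`_i)%Z.
  have [lt|le] := ltnP i p.
    rewrite /D coefB; case: p pp p5 lt {D} => // p _ _ lt.
    by rewrite clausen_low // subrr dvdz0.
  rewrite /D coefB rpredB //.
    rewrite expr2 coefM; apply: rpred_sum => j _.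
    have [ltj|lej] := ltnP j p; last by rewrite coef_poly ltnNge lej mul0r dvdz0.
    have [lt2|le2] := ltnP (i - j) p; last by rewrite [X in _ * X]coef_poly ltnNge le2 mulr0 dvdz0.
    rewrite !coef_poly ltj lt2 -PoszM /dvdz /=; apply: dvdn_sexticM => //.
    by have := ltn_ord j; lia.
  rewrite comp_polyE coef_sum; apply: rpred_sum => j _; rewrite coefZ.
  have ltj : (j < p)%N by apply: leq_trans (ltn_ord j) (size_poly _ _).
  rewrite coef_poly ltj.
  have [le2|gt2] := leqP p (2 * j).
    by apply: dvdz_mulr; apply: dvdn_clausen.
  rewrite [_`_i]nth_default ?mulr0 ?dvdz0 //.
  apply: leq_trans (size_poly_exp_leq _ _) _.
  have : (size clausen_arg <= 3)%N.
    apply/leq_sizeP => l le_l; rewrite /clausen_arg coefXM coefB coef1 mulrC coefXM coefC.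
    by case: l le_l => [|[|[|l]]].
  move=> sz; have : ((size clausen_arg).-1 * j <= 2 * j)%N by apply: leq_mul; lia.
  move=> h; apply: leq_ltn_trans h _; apply: leq_trans gt2 _; exact: le.
exists (\poly_(i < size D) (D`_i %/ (p ^ 2)%:Z)%Z).
rewrite addrC; apply/eqP; rewrite -subr_eq; apply/eqP; rewrite -/D.
apply/polyP => i; rewrite coefZ coef_poly.
case: ltnP => [lt|le]; last by rewrite nth_default // mulr0.
by rewrite mulrC divzK.
Qed.

(** * The quadratic character of a finite field *)

Definition quadchar (F : finFieldType) (x : F) : int :=
  if x == 0 then 0 else if [exists y : F, y ^+ 2 == x] then 1 else -1.

Lemma natr_card (F : finFieldType) : (#|F|%:R : F) = 0.
Proof.
have h : \sum_(x : F) x = \sum_(x : F) (x + 1).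
  by rewrite [LHS](reindex_inj (addIr (1 : F))).
move/eqP: h; rewrite big_split /= sumr_const -subr_eq0 opprD addrA subrr add0r.
by rewrite oppr_eq0 => /eqP.
Qed.

Lemma two_neq0 (F : finFieldType) : odd #|F| -> (2 : F) != 0.
Proof.
move=> oddF; apply/eqP => two0; have := natr_card F.
rewrite -(odd_double_half #|F|) oddF natrD -muln2 natrM two0 mulr0 addr0.
by move/eqP; rewrite oner_eq0.
Qed.

Lemma eq_oppr_eq0 (F : finFieldType) (x : F) : odd #|F| -> (x == - x) = (x == 0).
Proof.
move=> /two_neq0 t; rewrite -subr_eq0 opprK -mulr2n -mulr_natl mulf_eq0.
by rewrite (negPf t).
Qed.

Lemma expf_card1 (F : finFieldType) (x : F) : x != 0 -> x ^+ #|F|.-1 = 1.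
Proof.
move=> x0; apply: (mulfI x0); rewrite -exprS prednK ?expf_card ?mulr1 //.
by apply/card_gt0P; exists 0.
Qed.

(** The unit group is cyclic of order #|F| - 1, so an element killed by half of
that order is an even power of a generator. *)
Lemma sqr_of_expf1 (F : finFieldType) (x : F) :
  odd #|F| -> x != 0 -> x ^+ #|F|.-1./2 = 1 -> exists y : F, x = y ^+ 2.
Proof.
move=> oddF x0; set m := _./2.
have m2 : #|F|.-1 = (2 * m)%N by rewrite /m; lia.
have m_gt0 : (0 < m)%N.
  have : (1 < #|F|)%N by apply: finNzRing_gt1.
  lia.
have xU : x \is a GRing.unit by rewrite unitfE.
have /cyclicP[g hg] := field_unit_group_cyclic [set: {unit F}]%G.
have og : #[g]%g = (2 * m)%N.
  by rewrite -m2 -card_finField_unit orderE -hg.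
have := in_setT (FinRing.unit F xU); rewrite -[in X in _ \in X]/(gval _) hg.
move=> /cycleP[i hi] xm.
have hx : x = val g ^+ i by rewrite -FinRing.val_unitX -hi.
have : (#[g]%g %| i * m)%N.
  rewrite order_dvdn; apply/eqP/val_inj.
  by rewrite FinRing.val_unitX exprM -hx.
rewrite og dvdn_pmul2r // => /dvdnP[j hj].
by exists (val g ^+ j); rewrite -exprM hx hj.
Qed.

Lemma quadchar0 (F : finFieldType) : quadchar F 0 = 0.
Proof. by rewrite /quadchar eqxx. Qed.

Lemma quadchar_sqr (F : finFieldType) (x : F) : x != 0 -> quadchar F (x ^+ 2) = 1.
Proof.
move=> x0; rewrite /quadchar expf_eq0 /= (negPf x0).
by case: existsP => // -[]; exists x.
Qed.

Lemma quadchar1 (F : finFieldType) : quadchar F 1 = 1.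
Proof. by rewrite -(expr1n F 2) quadchar_sqr ?oner_eq0. Qed.

(** Euler's criterion. *)
Lemma quadchar_expf (F : finFieldType) (x : F) :
  odd #|F| -> (quadchar F x)%:~R = x ^+ #|F|.-1./2 :> F.
Proof.
move=> oddF; set m := _./2.
have m2 : #|F|.-1 = (m * 2)%N by rewrite /m; lia.
have m_gt0 : (0 < m)%N.
  have : (1 < #|F|)%N by apply: finNzRing_gt1.
  lia.
rewrite /quadchar; have [->|x0] := eqVneq; first by rewrite expr0n eqn0Ngt m_gt0.
case: existsP => [[y /eqP hy]|hN].
  have y0 : y != 0 by apply: contraNneq x0 => y0; rewrite -hy y0 expr0n.
  by rewrite -hy -exprM mulnC -m2 expf_card1.
have : (x ^+ m) ^+ 2 == 1 by rewrite -exprM -m2 expf_card1.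
rewrite sqrf_eq1 => /orP[/eqP h|/eqP -> //].
by case: hN; have [y ->] := sqr_of_expf1 F x oddF x0 h; exists y.
Qed.

Lemma quadchar_cases (F : finFieldType) (x : F) :
  [\/ quadchar F x = 0, quadchar F x = 1 | quadchar F x = -1].
Proof.
rewrite /quadchar; case: ifP => _; first by constructor 1.
by case: ifP => _; [constructor 2 | constructor 3].
Qed.

(** This lifts identities between character values from F to the integers. *)
Lemma sign_intr_inj (F : finFieldType) (a b : int) : odd #|F| ->
  [\/ a = 0, a = 1 | a = -1] -> [\/ b = 0, b = 1 | b = -1] ->
  a%:~R = b%:~R :> F -> a = b.
Proof.
move=> oddF; have h1 := oner_eq0 F; have h2 := eq_oppr_eq0 F 1 oddF.
rewrite h1 in h2.
have h3 : (-1 == 0 :> F) = false by rewrite oppr_eq0.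
by case=> ->; case=> -> //= /eqP;
  rewrite ?[_ == 0]eq_sym ?[0 == _]eq_sym ?h1 ?h2 ?h3 // eq_sym ?h1 ?h2 ?h3.
Qed.

Lemma quadcharM (F : finFieldType) (x y : F) :
  odd #|F| -> quadchar F (x * y) = quadchar F x * quadchar F y.
Proof.
move=> oddF; apply: (sign_intr_inj F _ _ oddF (quadchar_cases _ _)).
  case: (quadchar_cases F x) => ->; case: (quadchar_cases F y) => ->;
    by [constructor 1 | constructor 2 | constructor 3].
by rewrite intrM !quadchar_expf // exprMn.
Qed.

Lemma quadchar_eq0 (F : finFieldType) (x : F) : (quadchar F x == 0) = (x == 0).
Proof. by rewrite /quadchar; case: (x =P 0) => // _; case: ifP. Qed.

Lemma quadchar_sq (F : finFieldType) (x : F) :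
  quadchar F x ^+ 2 = (x != 0)%:R.
Proof. by rewrite /quadchar; case: (x =P 0) => //= _; case: ifP. Qed.

Lemma sqr_roots_count (F : finFieldType) (a : F) : odd #|F| ->
  \sum_(y : F) (y ^+ 2 == a)%:R = 1 + quadchar F a :> int.
Proof.
move=> oddF; rewrite /quadchar; have [->|a0] := eqVneq.
  rewrite (bigD1 0) //= expr0n eqxx big1 // => y y0.
  by rewrite expf_eq0 /= (negPf y0).
case: existsP => [[z /eqP hz]|hN]; last first.
  rewrite big1 // => y _; case: eqP => // h; case: hN; exists y; exact/eqP.
have z0 : z != 0 by apply: contraNneq a0 => h; rewrite -hz h expr0n.
have zN : - z != z by rewrite eq_sym eq_oppr_eq0.
rewrite (bigD1 z) //= hz eqxx (bigD1 (- z)) //= sqrrN hz eqxx.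
rewrite big1 ?addr0 // => y /andP[y1 y2].
by rewrite -hz eqf_sqr (negPf y1) (negPf y2).
Qed.

Lemma sum_quadchar (F : finFieldType) : odd #|F| -> \sum_(x : F) quadchar F x = 0.
Proof.
move=> oddF.
have h : \sum_(a : F) \sum_(y : F) (y ^+ 2 == a)%:R = (#|F|)%:R :> int.
  rewrite exchange_big /= -sum1_card natr_sum; apply: eq_bigr => y _.
  by rewrite (bigD1 (y ^+ 2)) //= eqxx big1 ?addr0 // => a /negPf; rewrite eq_sym => ->.
move/eqP: h; under eq_bigr do rewrite sqr_roots_count //.
by rewrite big_split /= sumr_const -[X in _ == X]addr0 (inj_eq (addrI _)) => /eqP.
Qed.

Lemma sum_quadchar_shift (F : finFieldType) (c : F) : odd #|F| ->
  \sum_(x : F) quadchar F (x + c) = 0.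
Proof.
by move=> oddF; rewrite -[RHS](sum_quadchar F oddF) [RHS](reindex_inj (addIr c)).
Qed.

(** After a shift the product is n (n + e), and for n <> 0 it has the character
of 1 + e/n, which takes every value but 1 once. *)
Lemma sum_quadchar_quadratic (F : finFieldType) (c d : F) : odd #|F| ->
  \sum_(n : F) quadchar F ((n + c) * (n + d)) = (#|F|)%:R * (c == d)%:R - 1 :> int.
Proof.
move=> oddF; rewrite (reindex_inj (addIr (- c))) /=.
under eq_bigr do rewrite -addrA addNr addr0 -addrA [- c + d]addrC.
have [<-|cd] := eqVneq c d.
  rewrite subrr mulr1 (bigD1 0) //= mul0r quadchar0 add0r.
  transitivity (\sum_(n : F | n != 0) (1 : int)).
    by apply: eq_bigr => n n0; rewrite addr0 -expr2 quadchar_sqr.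
  have <- : \sum_(n : F) (1 : int) = (#|F|)%:R by rewrite sumr_const.
  by rewrite [X in _ = X - 1](bigD1 0) //= addrAC subrr add0r.
rewrite mulr0 sub0r (bigD1 0) //= mul0r quadchar0 add0r.
set e := d - c; have e0 : e != 0 by rewrite subr_eq0 eq_sym.
transitivity (\sum_(n : F | n != 0) quadchar F (1 + e * n^-1)).
  apply: eq_bigr => n n0.
  have -> : n * (n + e) = n ^+ 2 * (1 + e * n^-1).
    by field.
  by rewrite quadcharM // quadchar_sqr // mul1r.
rewrite (reindex_inj (@invr_inj F)) /=.
rewrite (eq_bigl (fun n : F => n != 0)); last by move=> n; rewrite invr_eq0.
have := sum_quadchar F oddF.
rewrite (reindex_inj (addrI 1)) /= (reindex_inj (mulfI e0)) /= (bigD1 0) //=.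
rewrite mulr0 addr0 quadchar1 => /eqP; rewrite addrC addr_eq0 => /eqP <-.
by apply: eq_bigr => n _; rewrite invrK.
Qed.

(** * Jacobsthal sums *)

Definition jacobsthal (F : finFieldType) (n : F) : int :=
  \sum_(x : F) quadchar F (x ^+ 3 + n * x).

Lemma quadchar_opp1 (F : finFieldType) : odd #|F| ->
  quadchar F (-1) = (-1) ^+ #|F|.-1./2.
Proof.
move=> oddF; apply: (sign_intr_inj F _ _ oddF (quadchar_cases _ _)).
  by rewrite -signr_odd; case: (odd _); [constructor 3|constructor 2].
by rewrite quadchar_expf // rmorphXn /= rmorphN1.
Qed.

Lemma jacobsthal_scale (F : finFieldType) (n c : F) : odd #|F| -> c != 0 ->
  jacobsthal F (n * c ^+ 2) = quadchar F c * jacobsthal F n.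
Proof.
move=> oddF c0; rewrite /jacobsthal (reindex_inj (mulfI c0)) mulr_sumr /=.
apply: eq_bigr => x _.
have -> : (c * x) ^+ 3 + n * c ^+ 2 * (c * x) = (c * c ^+ 2) * (x ^+ 3 + n * x) by ring.
by rewrite quadcharM // quadcharM // quadchar_sqr // mulr1.
Qed.

Lemma jacobsthal0 (F : finFieldType) : odd #|F| -> jacobsthal F 0 = 0.
Proof.
move=> oddF; rewrite -[RHS](sum_quadchar F oddF); apply: eq_bigr => x _.
rewrite mul0r addr0 exprS quadcharM //.
have [->|x0] := eqVneq x 0; first by rewrite quadchar0 mul0r.
by rewrite quadchar_sqr // mulr1.
Qed.

Lemma jacobsthal_odd (F : finFieldType) (n : F) : odd #|F| ->
  quadchar F (-1) = -1 -> jacobsthal F n = 0.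
Proof.
move=> oddF hN; have : jacobsthal F n = - jacobsthal F n.
  rewrite {1}/jacobsthal (reindex_inj oppr_inj) /= /jacobsthal -sumrN.
  apply: eq_bigr => x _.
  have -> : (- x) ^+ 3 + n * - x = -1 * (x ^+ 3 + n * x) by ring.
  by rewrite quadcharM // hN mulN1r.
lia.
Qed.

Lemma sum_indicator_neq0 (F : finFieldType) :
  \sum_(x : F) (x != 0)%:R = (#|F|.-1)%:R :> int.
Proof.
have h : \sum_(x : F) (1 : int) = (#|F|)%:R by rewrite sumr_const.
rewrite (bigD1 0) //= eqxx add0r (eq_bigr (fun=> 1)); last by move=> x ->.
move: h; rewrite (bigD1 0) //= => h; have := finNzRing_gt1 F.
by move: h; set s := \sum_(_ | _) _; move=> h gt1; rewrite -subn1 natrB ?(ltnW gt1) // -h addrAC subrr add0r.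
Qed.

(** Expand the square, and sum over n first: only the pairs x = y and x = - y
survive, because the sum of the character is 0. *)
Lemma sum_jacobsthal_sq (F : finFieldType) : odd #|F| -> quadchar F (-1) = 1 ->
  \sum_(n : F) jacobsthal F n ^+ 2 = 2 * (#|F|)%:R * (#|F|.-1)%:R :> int.
Proof.
move=> oddF h1.
transitivity (\sum_(x : F) \sum_(y : F) quadchar F (x * y) *
   ((#|F|)%:R * (x ^+ 2 == y ^+ 2)%:R - 1)).
  under eq_bigr => n _.
    rewrite expr2 {1}/jacobsthal mulr_suml.
    under eq_bigr do rewrite /jacobsthal mulr_sumr.
    over.
  rewrite exchange_big /=; apply: eq_bigr => x _.
  rewrite exchange_big /=; apply: eq_bigr => y _.
  rewrite -sum_quadchar_quadratic // mulr_sumr; apply: eq_bigr => n _.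
  by rewrite -!quadcharM //; congr quadchar; ring.
transitivity (\sum_(x : F) ((#|F|)%:R * (2 * (x != 0)%:R) : int)); last first.
  rewrite -mulr_sumr -mulr_sumr mulrA [_ * 2]mulrC; congr (_ * _).
  exact: sum_indicator_neq0.
apply: eq_bigr => x _.
under eq_bigr do rewrite mulrBr mulr1 mulrCA.
rewrite sumrB -mulr_sumr.
under [X in _ - X]eq_bigr do rewrite quadcharM //.
rewrite -[X in _ - X]mulr_sumr sum_quadchar // mulr0 subr0; congr (_ * _).
have [->|x0] := eqVneq x 0.
  by rewrite mulr0 big1 // => y _; rewrite mul0r quadchar0 mul0r.
have xN : - x != x by rewrite eq_sym eq_oppr_eq0.
rewrite (bigD1 x) //= eqxx (bigD1 (- x)) //= sqrrN eqxx mulrN -mulN1r (quadcharM F (-1)) //.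
rewrite h1 mul1r -expr2 quadchar_sqr // big1 ?mulr1 // => y /andP[y1 y2].
by rewrite eq_sym eqf_sqr (negPf y1) (negPf y2) mulr0.
Qed.

Lemma exists_nonsquare (F : finFieldType) : odd #|F| ->
  exists g : F, quadchar F g = -1.
Proof.
move=> oddF; case: (pickP (fun g : F => quadchar F g == -1)) => [g /eqP|h].
  by exists g.
have := sum_quadchar F oddF => /eqP; rewrite psumr_eq0 /=; last first.
  by move=> x _; case: (quadchar_cases F x) => hx; rewrite hx //; have := h x; rewrite hx eqxx.
move/allP/(_ 1 (mem_index_enum _)); by rewrite quadchar1.
Qed.

(** Up to sign a Jacobsthal sum at n <> 0 only depends on the class of n modulo
squares, so the total of the squares consists of two values, each taken
(#|F| - 1)/2 times. *)
Lemma jacobsthal_sqs (F : finFieldType) : odd #|F| -> quadchar F (-1) = 1 ->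
  exists g : F,
    jacobsthal F (-1) ^+ 2 + jacobsthal F g ^+ 2 = 4 * (#|F|)%:R.
Proof.
move=> oddF hN; have [g hg] := exists_nonsquare F oddF; exists g.
have g0 : g != 0 by rewrite -quadchar_eq0 hg.
have sq (a b : F) : a != 0 -> b != 0 -> quadchar F (b / a) = 1 ->
    jacobsthal F b ^+ 2 = jacobsthal F a ^+ 2.
  move=> a0 b0 h.
  have ba0 : b / a != 0 by rewrite mulf_neq0 ?invr_eq0.
  have [c hc] : exists c : F, b / a = c ^+ 2.
    move: h; rewrite /quadchar (negPf ba0); case: existsP => // -[c /eqP <-] _.
    by exists c.
  have c0 : c != 0 by move: ba0; rewrite hc expf_eq0.
  rewrite -[b](divfK a0) mulrC hc jacobsthal_scale // exprMn quadchar_sq c0.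
  by rewrite mul1r.
set J1 := jacobsthal F (-1); set Jg := jacobsthal F g.
have key (n : F) : 2 * jacobsthal F n ^+ 2 =
   (n != 0)%:R * (J1 ^+ 2 + Jg ^+ 2) + quadchar F n * (J1 ^+ 2 - Jg ^+ 2).
  have [->|n0] := eqVneq n 0.
    by rewrite jacobsthal0 // quadchar0 expr0n /= !mul0r mulr0.
  have N10 : (-1 : F) != 0 by rewrite oppr_eq0 oner_eq0.
  case: (quadchar_cases F n) => hn.
  - by move/eqP: hn; rewrite quadchar_eq0 (negPf n0).
  - have -> : jacobsthal F n ^+ 2 = J1 ^+ 2.
      by apply: sq => //; rewrite invrN invr1 mulrN1 -mulN1r quadcharM // hN hn.
    by rewrite hn /=; ring.
  - have -> : jacobsthal F n ^+ 2 = Jg ^+ 2.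
      apply: sq => //; rewrite quadcharM // hn.
      have : quadchar F g * quadchar F g^-1 = 1.
        by rewrite -quadcharM // divff // quadchar1.
      by rewrite hg.
    by rewrite hn /=; ring.
have := sum_jacobsthal_sq F oddF hN => /(congr1 (fun z => 2 * z)).
rewrite mulr_sumr; under eq_bigr do rewrite key.
rewrite big_split /= -!mulr_suml sum_quadchar // mul0r addr0.
rewrite sum_indicator_neq0.
have : (#|F|.-1)%:R != 0 :> int.
  by rewrite pnatr_eq0 -lt0n; have : (1 < #|F|)%N by [apply: finNzRing_gt1]; lia.
move=> h e; apply: (mulfI h); rewrite e; ring.
Qed.

(** It selects exactly one of x and - x when x <> 0; any choice would do, and the
enumeration of F provides one. *)
Definition half_system (F : finFieldType) (x : F) : bool :=
  (enum_rank x < enum_rank (- x))%N.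

Lemma sum_even (F : finFieldType) (f : F -> int) : odd #|F| ->
  f 0 = 0 -> (forall x, f (- x) = f x) ->
  \sum_(x : F) f x = 2 * \sum_(x : F | half_system F x) f x.
Proof.
move=> oddF f0 fN; rewrite (bigID (half_system F)) /= mulr_natl mulr2n; congr (_ + _).
rewrite (bigID (fun x => x == 0)) /= big1 ?add0r; last first.
  by move=> x /andP[_ /eqP ->].
rewrite (reindex_inj oppr_inj) /=; apply: eq_big => // x.
rewrite /half_system opprK oppr_eq0 -leqNgt.
have [->|x0] := eqVneq x 0; first by rewrite oppr0 ltnn andbF.
rewrite andbT ltn_neqAle.
suff -> : (nat_of_ord (enum_rank x) != enum_rank (- x)) = true by [].
by rewrite (inj_eq val_inj) (inj_eq enum_rank_inj) eq_oppr_eq0.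
Qed.

Lemma jacobsthal_even (F : finFieldType) (n : F) : odd #|F| ->
  quadchar F (-1) = 1 ->
  jacobsthal F n = 2 * \sum_(x : F | half_system F x) quadchar F (x ^+ 3 + n * x).
Proof.
move=> oddF h; apply: sum_even => //.
  by rewrite expr0n mulr0 addr0 quadchar0.
move=> x; have -> : (- x) ^+ 3 + n * - x = -1 * (x ^+ 3 + n * x) by ring.
by rewrite quadcharM // h mul1r.
Qed.

(** Both sums in [jacobsthal_sqs] are twice a sum over half of F.  For the
first one, the parity of the half sum is that of the number of its nonzero
terms, which is (#|F| - 3)/2, an odd number. *)
Lemma jacobsthal_two_squares (F : finFieldType) : (#|F| = 1 %[mod 4])%N ->
  exists u v : int, [/\ jacobsthal F (-1) = 2 * u, ~~ (2 %| u)%Z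
    & (#|F|)%:Z = u ^+ 2 + v ^+ 2].
Proof.
move=> F1; have oddF : odd #|F| by lia.
have hN : quadchar F (-1) = 1.
  by rewrite quadchar_opp1 // -signr_odd; have -> : odd #|F|.-1./2 = false by lia.
have [g] := jacobsthal_sqs F oddF hN.
rewrite !jacobsthal_even // => e.
set u := \sum_(_ | _) _ in e *; set v := \sum_(_ | _) _ in e.
exists u, v; split => //; last by lia.
(* This even function counts the nonzero terms, and has the parity of the
   terms of u. *)
pose ev (x : F) := quadchar F (x ^+ 3 + -1 * x) ^+ 2.
have evN x : ev (- x) = ev x.
  rewrite /ev; have -> : (- x) ^+ 3 + -1 * - x = -1 * (x ^+ 3 + -1 * x) by ring.
  by rewrite quadcharM // hN mul1r.
have ev0 : ev 0 = 0 by rewrite /ev expr0n mulr0 addr0 quadchar0 expr0n.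
have := sum_even F ev oddF ev0 evN; set w := \sum_(x | half_system F x) _.
have -> : \sum_(x : F) ev x = (#|F|)%:R - 3.
  have h : \sum_(x : F) (1 : int) = (#|F|)%:R by rewrite sumr_const.
  have N1 : (-1 : F) != 1 by rewrite eq_sym eq_oppr_eq0 // oner_eq0.
  have N0 : (-1 : F) != 0 by rewrite oppr_eq0 oner_eq0.
  rewrite -h (bigD1 0) //= [in RHS](bigD1 0) //= ev0.
  rewrite (bigD1 1) ?oner_eq0 //= [in RHS](bigD1 1) ?oner_eq0 //=.
  rewrite (bigD1 (-1)) ?N0 ?N1 //= [in RHS](bigD1 (-1)) ?N0 ?N1 //=.
  have e1 : ev 1 = 0 by rewrite /ev expr1n mulr1 subrr quadchar0 expr0n.
  have -> : ev (-1) = 0 by rewrite evN.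
  rewrite e1 (eq_bigr (fun=> 1)); first by ring.
  move=> x /andP[/andP[x0 x1] xN]; rewrite /ev quadchar_sq.
  have -> : x ^+ 3 + -1 * x = x * ((x - 1) * (x + 1)) by ring.
  by rewrite !mulf_eq0 (negPf x0) subr_eq0 (negPf x1) addr_eq0 (negPf xN).
move=> hw; have : (2 %| u - w)%Z.
  rewrite /u /w -sumrB; apply: rpred_sum => x _; rewrite /ev.
  by case: (quadchar_cases F (x ^+ 3 + -1 * x)) => ->.
lia.
Qed.

(** The product (a u - b v)(a u + b v) is a multiple of p, so one factor is; then
Brahmagupta's identity (a u - b v)^2 + (a v + b u)^2 = p^2 forces one of the
two squares to vanish.  Parity excludes the case a^2 = v^2. *)
Lemma prime_two_squares_uniq (p : nat) (a b u v : int) : prime p -> odd p ->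
  p%:Z = a ^+ 2 + b ^+ 2 -> p%:Z = u ^+ 2 + v ^+ 2 ->
  ~~ (2 %| a)%Z -> ~~ (2 %| u)%Z -> a ^+ 2 = u ^+ 2.
Proof.
move=> pp oddp hab huv oa ou.
wlog : v huv / (p%:Z %| a * u - b * v)%Z.
  move=> W; have : (p%:Z %| (a * u - b * v) * (a * u - b * - v))%Z.
    apply/dvdzP; exists (a ^+ 2 + u ^+ 2 - p%:Z).
    rewrite (_ : _ * _ = a ^+ 2 * u ^+ 2 - b ^+ 2 * v ^+ 2); last by ring.
    have -> : v ^+ 2 = p%:Z - u ^+ 2 by rewrite huv; ring.
    have -> : b ^+ 2 = p%:Z - a ^+ 2 by rewrite hab; ring.
    ring.
  rewrite dvdzE abszM absz_nat Euclid_dvdM // => /orP[h|h]; first exact: (W v).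
  by apply: (W (- v)); rewrite ?sqrrN.
move=> /dvdzP[k hk].
have hs : (a * u - b * v) ^+ 2 + (a * v + b * u) ^+ 2 = p%:Z ^+ 2.
  by transitivity ((a ^+ 2 + b ^+ 2) * (u ^+ 2 + v ^+ 2)); [ring | rewrite -hab -huv expr2].
have p0 : p%:Z != 0 by have := prime_gt0 pp; lia.
have /dvdzP[l hl] : (p%:Z %| a * v + b * u)%Z.
  have : (p%:Z %| (a * v + b * u) ^+ 2)%Z.
    apply/dvdzP; exists (p%:Z - k ^+ 2 * p%:Z).
    rewrite (_ : (a * v + b * u) ^+ 2 = p%:Z ^+ 2 - (a * u - b * v) ^+ 2); last by rewrite -hs; ring.
    by rewrite hk; ring.
  by rewrite !dvdzE abszX absz_nat Euclid_dvdX // => /andP[].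
have kl : k ^+ 2 + l ^+ 2 = 1.
  apply: (mulfI (expf_neq0 2 p0)); rewrite mulr1 -[RHS]hs hk hl; ring.
have {kl} [k0|l0] : k = 0 \/ l = 0.
  have [->|k0] := eqVneq k 0; [by left | right].
  have : 0 < k ^+ 2 by rewrite exprn_even_gt0.
  have lin (A B : int) : A + B = 1 -> 0 < A -> 0 <= B -> B = 0 by clear; lia.
  by move=> /(lin _ _ kl)/(_ (sqr_ge0 l))/eqP; rewrite sqrf_eq0 => /eqP.
  exfalso; move: hk; rewrite k0 mul0r => hk.
  have : b ^+ 2 = u ^+ 2.
    have : a ^+ 2 * u ^+ 2 = b ^+ 2 * v ^+ 2 by rewrite -!exprMn; congr (_ ^+ 2); apply/eqP; rewrite -subr_eq0 hk.
    have -> : v ^+ 2 = p%:Z - u ^+ 2 by rewrite huv; ring.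
    have -> : a ^+ 2 = p%:Z - b ^+ 2 by rewrite hab; ring.
    move=> e; apply: (mulfI p0); apply/eqP; rewrite -subr_eq0; apply/eqP.
    transitivity (b ^+ 2 * (p%:Z - u ^+ 2) - (p%:Z - b ^+ 2) * u ^+ 2); first by ring.
    by rewrite e subrr.
  move=> hbu.
  have par (x : int) : (2 %| x ^+ 2)%Z = (2 %| x)%Z.
    by rewrite !dvdzE abszX Euclid_dvdX // andbT.
  have lin (P A U : int) : P = A + U -> ~~ (2 %| A)%Z -> ~~ (2 %| U)%Z -> (2 %| P)%Z.
    by clear; lia.
  move: hab; rewrite hbu => /lin; rewrite !par => /(_ oa ou).
  by rewrite dvdzE !absz_nat dvdn2 oddp.
move: hl; rewrite l0 mul0r => hl.
have : a ^+ 2 * v ^+ 2 = b ^+ 2 * u ^+ 2.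
  by rewrite -!exprMn -[RHS]sqrrN; congr (_ ^+ 2); apply/eqP; rewrite -addr_eq0 hl.
have -> : v ^+ 2 = p%:Z - u ^+ 2 by rewrite huv; ring.
have -> : b ^+ 2 = p%:Z - a ^+ 2 by rewrite hab; ring.
move=> e; apply: (mulfI p0); apply/eqP; rewrite -subr_eq0; apply/eqP.
transitivity (a ^+ 2 * (p%:Z - u ^+ 2) - (p%:Z - a ^+ 2) * u ^+ 2); first by ring.
by rewrite e subrr.
Qed.

(** Translation by 2 turns the cubic into x (x^2 + 6 x + 1), whose character at
x <> 0 is that of u + 6 with u = x + 1/x.  A given u occurs
1 + chi(u^2 - 4) times, which is the 2-isogeny onto the curve
Y^2 = (u + 6)(u^2 - 4); with u = 4 w - 2 the right side is 64 (w^3 - w). *)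
Lemma isogeny_sum (F : finFieldType) : odd #|F| ->
  \sum_(x : F) quadchar F (x ^+ 3 - 11 * x + 14) = jacobsthal F (-1).
Proof.
move=> oddF; have t0 := two_neq0 F oddF.
have f0 : (4 : F) != 0 by rewrite (_ : 4 = 2 * 2 :> F) ?mulf_neq0 //; ring.
rewrite (reindex_inj (addIr 2)) /=.
transitivity (\sum_(x : F | x != 0) quadchar F (x + x^-1 + 6)).
  rewrite (bigD1 0) //= (_ : _ + 14 = 0) ?quadchar0 ?add0r; last by ring.
  apply: eq_bigr => x x0.
  rewrite (_ : _ + 14 = x ^+ 2 * (x + x^-1 + 6)); last by field.
  by rewrite quadcharM // quadchar_sqr // mul1r.
transitivity (\sum_(u : F) quadchar F (u + 6) * (1 + quadchar F (u ^+ 2 - 4))).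
  transitivity (\sum_(u : F) \sum_(x : F | x != 0) quadchar F (u + 6) * (x + x^-1 == u)%:R).
    rewrite exchange_big /=; apply: eq_bigr => x _.
    rewrite (bigD1 (x + x^-1)) //= eqxx mulr1 big1 ?addr0 // => u.
    by rewrite eq_sym => /negPf ->; rewrite mulr0.
  apply: eq_bigr => u _; rewrite -mulr_sumr; congr (_ * _).
  rewrite -sqr_roots_count //.
  rewrite [RHS](reindex_inj (addIr (- u))) [RHS](reindex_inj (mulfI t0)) /=.
  rewrite [RHS](bigD1 0) //= mulr0 add0r sqrrN.
  have -> : (u ^+ 2 == u ^+ 2 - 4) = false.
    by rewrite -subr_eq0 opprB addrC subrK (negPf f0).
  rewrite add0r; apply: eq_bigr => x x0; congr (nat_of_bool _)%:R.
  rewrite -subr_eq0 -[RHS]subr_eq0.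
  rewrite (_ : (2 * x - u) ^+ 2 - (u ^+ 2 - 4) = (4 * x) * (x + x^-1 - u)); last by field.
  by rewrite !mulf_eq0 (negPf f0) (negPf x0).
under eq_bigr do rewrite mulrDr mulr1 -quadcharM //.
rewrite big_split /= sum_quadchar_shift // add0r.
rewrite (reindex_inj (addIr (-2))) /= (reindex_inj (mulfI f0)) /=.
apply: eq_bigr => w _.
rewrite (_ : _ * _ = (8%:R ^+ 2) * (w ^+ 3 + -1 * w)); last by ring.
rewrite quadcharM // quadchar_sqr ?mul1r //.
by rewrite (_ : 8 = 2 * 4 :> F) ?mulf_neq0 //; ring.
Qed.

(** * The Hasse invariant of a cubic *)

(** For an exponent that is not a multiple of #|F| - 1, multiplying x by an
element g with g^j <> 1 shows that the sum vanishes. *)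
Lemma power_sum (F : finFieldType) j : (j < 2 * #|F|.-1)%N ->
  \sum_(x : F) x ^+ j = - (j == #|F|.-1)%:R.
Proof.
have gt1 : (1 < #|F|)%N by [apply: finNzRing_gt1].
wlog : j / (j <= #|F|.-1)%N => [W ltj|].
  have [le|gt] := leqP j #|F|.-1; first exact: W.
  rewrite (gtn_eqF gt) oppr0.
  transitivity (\sum_(x : F) x ^+ (j - #|F|.-1)).
    apply: eq_bigr => x _; have [->|x0] := eqVneq x 0.
      by rewrite !expr0n; congr (nat_of_bool _)%:R; lia.
    by rewrite -{1}(subnK (ltnW gt)) exprD expf_card1 // mulr1.
  rewrite W; try lia.
  suff -> : (j - #|F|.-1 == #|F|.-1)%N = false by rewrite oppr0.
  by lia.
move=> lej _; have [->|jN] := eqVneq j #|F|.-1.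
  have h : \sum_(x : F | x != 0) (1 : F) = - 1.
    have := natr_card F; rewrite -sum1_card natr_sum (bigD1 0) //= => /eqP.
    by rewrite addrC addr_eq0 => /eqP.
  rewrite (bigD1 0) //= -[RHS]/(- 1) -[RHS]h.
  case E : #|F|.-1 => [|q]; first by lia.
  by rewrite expr0n add0r -E; apply: eq_bigr => x x0; rewrite expf_card1.
rewrite oppr0; have [->|j0] := eqVneq j 0%N.
  by under eq_bigr do rewrite expr0; rewrite sumr_const natr_card.
(* Otherwise X^j - 1 would have #|F| - 1 > j roots. *)
case: (pickP (fun g : F => (g != 0) && (g ^+ j != 1))) => [g /andP[g0 gj]|h].
  have : \sum_(x : F) x ^+ j = g ^+ j * \sum_(x : F) x ^+ j.
    rewrite [LHS](reindex_inj (mulfI g0)) mulr_sumr /=.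
    by apply: eq_bigr => x _; rewrite exprMn.
  move/eqP; rewrite -subr_eq0 -{1}[\sum_x _]mul1r -mulrBl mulf_eq0 subr_eq0.
  by rewrite eq_sym (negPf gj) => /eqP.
have szP : size ('X^j - 1%:P : {poly F}) = j.+1 by rewrite size_XnsubC // lt0n.
have P0 : 'X^j - 1%:P != 0 :> {poly F} by rewrite -size_poly_eq0 szP.
have := max_poly_roots P0 _ (enum_uniq (predC1 (0 : F))).
rewrite -cardE cardC1 szP ltnS leqNgt ltn_neqAle jN lej => W; have /W // : all (root ('X^j - 1%:P)) (enum (predC1 (0 : F))).
apply/allP => x; rewrite mem_enum inE => x0; rewrite rootE !hornerE.
by have := h x; rewrite x0 /= => /negbFE/eqP ->; rewrite subrr.
Qed.

Lemma sum_horner (F : finFieldType) (K : fieldType) (iota : {rmorphism F -> K})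
    (P : {poly K}) : (size P <= 2 * #|F|.-1)%N ->
  \sum_(x : F) P.[iota x] = - P`_#|F|.-1.
Proof.
move=> szP; have gt1 : (1 < #|F|)%N by [apply: finNzRing_gt1].
have e x : P.[iota x] = \sum_(i < 2 * #|F|.-1) P`_i * iota (x ^+ i).
  by rewrite (horner_coef_wide _ szP); apply: eq_bigr => i _; rewrite rmorphXn.
under eq_bigr do rewrite e.
rewrite exchange_big /=.
have lt : (#|F|.-1 < 2 * #|F|.-1)%N by lia.
rewrite (bigD1 (Ordinal lt)) //= [X in _ + X]big1 => [|i iN].
  by rewrite addr0 -mulr_sumr -rmorph_sum power_sum // eqxx rmorphN1 mulrN1.
rewrite -mulr_sumr -rmorph_sum power_sum //.
have -> : (nat_of_ord i == #|F|.-1)%N = false by apply: negPf iN.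
by rewrite oppr0 rmorph0 mulr0.
Qed.

(** Up to sign, the coefficient is the sum of the values over all of F, which
is invariant under translation. *)
Lemma coef_translate (F : finFieldType) (K : fieldType) (iota : {rmorphism F -> K})
    (P : {poly K}) (a : F) : (size P <= 2 * #|F|.-1)%N ->
  (P \Po ('X + (iota a)%:P))`_#|F|.-1 = P`_#|F|.-1.
Proof.
move=> szP; apply: oppr_inj; rewrite -!(sum_horner _ _ iota) //; last first.
  by rewrite size_comp_poly2 // size_XaddC.
rewrite [RHS](reindex_inj (addIr a)) /=; apply: eq_bigr => x _.
by rewrite horner_comp !hornerE rmorphD.
Qed.

(** For m = (p-1)/2 and a field of characteristic p, this is the Hasse invariant
of the curve Y^2 = X^3 + a X + b. *)
Definition hasse (K : fieldType) (m : nat) (a b : K) : K :=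
  (('X^3 + a *: 'X + b%:P) ^+ m)`_(2 * m).

Lemma size_weierstrass (K : fieldType) (m : nat) (a b : K) :
  (size (('X^3 + a *: 'X + b%:P) ^+ m) <= (3 * m).+1)%N.
Proof.
apply: leq_trans (size_poly_exp_leq _ _) _; rewrite ltnS leq_mul2r; apply/orP; right.
rewrite -subn1 leq_subLR -addrA size_polyDl ?size_polyXn //.
apply: leq_ltn_trans (size_polyD _ _) _; rewrite gtn_max.
rewrite (leq_ltn_trans (size_scale_leq _ _)) ?size_polyX //.
by rewrite (leq_ltn_trans (size_polyC_leq1 _)).
Qed.

Lemma coef_compZX (K : fieldType) (P : {poly K}) (s : K) i :
  (P \Po (s *: 'X))`_i = s ^+ i * P`_i.
Proof.
rewrite coef_comp_poly; have [lt|le] := ltnP i (size P).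
  rewrite (bigD1 (Ordinal lt)) //= exprZn coefZ coefXn eqxx mulr1 mulrC.
  rewrite big1 ?addr0 // => j jN; rewrite exprZn coefZ coefXn.
  have -> : (i == j)%N = false by rewrite eq_sym; apply: negPf; exact: jN.
  by rewrite !mulr0.
rewrite [P`_i]nth_default // mulr0 big1 // => j _.
rewrite exprZn coefZ coefXn gtn_eqF ?mulr0 //.
by apply: leq_trans le.
Qed.

Lemma hasse_scale (K : fieldType) (m : nat) (s a b : K) : s != 0 ->
  hasse K m (s ^+ 2 * a) (s ^+ 3 * b) = s ^+ m * hasse K m a b.
Proof.
move=> s0; apply: (mulfI (expf_neq0 (2 * m) s0)).
rewrite /hasse -coef_compZX mulrA -exprD (_ : 2 * m + m = 3 * m)%N; last by lia.
have -> : (('X^3 + (s ^+ 2 * a) *: 'X + (s ^+ 3 * b)%:P) ^+ m \Po (s *: 'X)) =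
   (s ^+ 3) ^+ m *: ('X^3 + a *: 'X + b%:P) ^+ m.
  rewrite rmorphXn -exprZn /=; congr (_ ^+ _).
  rewrite !comp_polyD comp_polyZ comp_polyC rmorphXn /= comp_polyX.
  by rewrite -!mul_polyC !(polyCM, polyC_exp); ring.
by rewrite coefZ exprM.
Qed.

Lemma hasse_quadchar (F : finFieldType) (K : fieldType) (iota : {rmorphism F -> K})
    (a b : F) : odd #|F| ->
  hasse K #|F|.-1./2 (iota a) (iota b)
    = - (\sum_(x : F) quadchar F (x ^+ 3 + a * x + b))%:~R.
Proof.
move=> oddF; set m := _./2; have gt1 : (1 < #|F|)%N by [apply: finNzRing_gt1].
have m2 : #|F|.-1 = (2 * m)%N by rewrite /m; lia.
have m1 : (0 < m)%N by lia.
rewrite /hasse; apply: oppr_inj; rewrite opprK -m2 -(sum_horner _ _ iota); last first.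
  by apply: leq_trans (size_weierstrass _ _ _ _) _; rewrite m2; lia.
rewrite rmorph_sum /=; apply: eq_bigr => x _.
rewrite -(rmorph_int iota) quadchar_expf // -/m rmorphXn /=.
by rewrite !hornerE !(rmorphD, rmorphM, rmorphXn).
Qed.

(** * The Hasse invariant as a truncated hypergeometric series *)

Lemma coef_XaddC_exp (K : fieldType) (c : K) n j :
  (('X + c%:P) ^+ n)`_j = c ^+ (n - j) *+ 'C(n, j).
Proof.
rewrite addrC exprDn.
rewrite (eq_bigr (fun i : 'I_n.+1 => (c ^+ (n - i) *+ 'C(n, i)) *: 'X^i)).
  rewrite -(poly_def n.+1 (fun i => c ^+ (n - i) *+ 'C(n, i))) coef_poly ltnS.
  by case: leqP => // lt; rewrite bin_small.
by move=> i _; rewrite -polyC_exp -mulrnAl -polyCMn mul_polyC.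
Qed.

(** Since m = -1/2 modulo p, the falling factorial of m is, up to sign and powers
of 2, the product of the first r odd numbers, that is (2r)! / (2^r r!). *)
Lemma ffact_half (K : fieldType) p m r : p \in [char K] -> p = m.*2.+1 ->
  (r <= m)%N ->
  2 ^+ (2 * r) * (m ^_ r)%:R * (r`!)%:R = (-1) ^+ r * ((2 * r)`!)%:R :> K.
Proof.
move=> pK pm; have p0 : m%:R *+ 2 + 1 = 0 :> K.
  by rewrite -mulrnA natr1 muln2 -pm; apply/eqP; rewrite -(dvdn_pcharf pK).
elim: r => [|r IH] lt_r.
  by rewrite muln0 !expr0 ffactn0 !fact0 !mul1r.
have -> : (2 * r.+1 = (2 * r).+2)%N by lia.
rewrite ffactnSr !factS !natrM natrB; last by exact: ltnW.
transitivity (2 ^+ (2 * r) * (m ^_ r)%:R * (r`!)%:R *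
   (2 * (m%:R *+ 2 - 2 * r%:R) * r.+1%:R) : K).
  by rewrite !exprS; ring.
rewrite IH; last by exact: ltnW.
have -> : m%:R *+ 2 = -1 :> K by apply/eqP; rewrite -addr_eq0 p0.
rewrite -!natr1 natrM exprS; ring.
Qed.

Lemma natr_neq0 (K : fieldType) p n : p \in [char K] ->
  (0 < n < p)%N -> n%:R != 0 :> K.
Proof.
move=> pK /andP[n0 ltn]; rewrite -(dvdn_pcharf pK).
by apply/negP => /(dvdn_leq n0); rewrite leqNgt ltn.
Qed.

Lemma fact_natr_neq0 (K : fieldType) p n : p \in [char K] ->
  (n < p)%N -> (n`!)%:R != 0 :> K.
Proof.
move=> pK; elim: n => [|n IH] ltn; first by rewrite fact0 oner_eq0.
rewrite factS natrM mulf_neq0 //; last by apply: IH; exact: ltnW.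
exact: (natr_neq0 _ _ _ pK).
Qed.

(** Both sides vanish when 3k > m.  Otherwise the left side is a falling
factorial of m of length 3k divided by k! (2k)!, to which
[ffact_half] applies with r = 3k. *)
Lemma sextic_half (K : fieldType) p m k : p \in [char K] -> (5 <= p)%N ->
  p = m.*2.+1 -> (k < p)%N ->
  2 ^+ (6 * k) * ('C(m, k) * 'C(m - k, 2 * k))%:R
    = (-1) ^+ k * (sextic k)%:R :> K.
Proof.
move=> pK p5 pm ltkp; have pp : prime p by case/andP: pK.
have [le|gt] := leqP (3 * k) m; last first.
  rewrite [in LHS](@bin_small (m - k)) ?muln0 ?mulr0; last by lia.
  have /eqP -> : (sextic k)%:R == 0 :> K; last by rewrite mulr0.
  by rewrite -(dvdn_pcharf pK); apply: dvdn_sextic => //; lia.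
have lt3 : (3 * k < p)%N by lia.
have f0 : ((k`! * (2 * k)`! * (3 * k)`!)%:R != 0 :> K).
  by rewrite !natrM !mulf_neq0 //; apply: (fact_natr_neq0 _ _ _ pK); lia.
apply: (mulIf f0); rewrite -[RHS]mulrA -natrM sextic_fact.
have e6 : (6 * k = 2 * (3 * k))%N by lia.
have <- : (-1) ^+ (3 * k) = (-1) ^+ k :> K.
  by rewrite -signr_odd oddM /= signr_odd.
rewrite e6 -(ffact_half _ _ _ _ pK pm le) -!mulrA; congr (_ * _).
rewrite -!natrM; congr (_%:R).
have h1 := @bin_fact m k ltac:(lia).
have h2 := @bin_fact (m - k) (2 * k) ltac:(lia).
have h3 := ffact_fact le.
have e1 : (m - k - 2 * k = m - 3 * k)%N by lia.
rewrite e1 in h2.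
apply/eqP; rewrite -(@eqn_pmul2r (m - 3 * k)`!) ?fact_gt0 //; apply/eqP.
transitivity ((3 * k)`! * ('C(m, k) * (k`! * ('C(m - k, 2 * k) * ((2 * k)`! * (m - 3 * k)`!)))))%N.
  by ring.
by rewrite h2 h1 -h3; ring.
Qed.

(** For d = 0 the cubic has its node at X = 1; moving the node to the origin
leaves only two terms, so that the coefficients of the power are products of
two binomials. *)
Lemma weierstrass_translate (K : fieldType) (d : K) :
  ('X^3 + -3 *: 'X + (2 + d)%:P) \Po ('X + 1%:P) = 'X^2 * ('X + 3%:P) + d%:P.
Proof.
have [t ht] : exists t : K, t = 3 by exists 3.
have [e he] : exists t : K, t = 2 by exists 2.
have ct : t%:P = 3 by rewrite ht; apply: (rmorph_nat (@polyC K)).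
have ce : e%:P = 2 by rewrite he; apply: (rmorph_nat (@polyC K)).
rewrite -ht -he.
rewrite !comp_polyD comp_polyZ comp_polyC rmorphXn /= comp_polyX.
rewrite -!mul_polyC polyCN polyCD ct ce polyC1; ring.
Qed.

(** Expand (X^2 (X + 3) - 1728 x)^m by the binomial formula twice, and compare
the coefficients of x^k. *)
Lemma hasse_sextic (K : fieldType) p (iota : {rmorphism 'F_p -> K}) (x : K) :
  p \in [char K] -> (5 <= p)%N -> 
  hasse K p./2 (-3) (2 - 1728 * x)
    = 3 ^+ p./2 * (map_poly intr (sextic_poly p)).[x].
Proof.
move=> pK p5; have pp : prime p by case/andP: pK.
have oddp : odd p by case: (even_prime pp) => // h; rewrite h in p5.
have cF := card_Fp pp.
set m := p./2; have pm : p = m.*2.+1 by rewrite -[LHS]odd_double_half oddp.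
have m2 : #|'F_p|.-1 = (2 * m)%N by rewrite cF; lia.
set d := - (1728 * x).
rewrite /hasse -m2 -(coef_translate _ _ iota _ 1) ?m2; last first.
  apply: leq_trans (size_weierstrass _ _ _ _) _; lia.
rewrite rmorph1 rmorphXn /=.
rewrite weierstrass_translate.
rewrite exprDn coef_sum.
transitivity (\sum_(k < m.+1) 3 ^+ m * (sextic k)%:R * x ^+ k : K).
  apply: eq_bigr => -[k /= ltk] _.
  rewrite coefMn -polyC_exp coefMC exprMn -exprM coefXnM.
  have -> : (2 * m < 2 * (m - k))%N = false by lia.
  have -> : (2 * m - 2 * (m - k) = 2 * k)%N by lia.
  rewrite coef_XaddC_exp.
  have ltkp : (k < p)%N by lia.
  have := sextic_half _ _ _ _ pK p5 pm ltkp.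
  have [le|gt] := leqP (3 * k) m; last first.
    rewrite ['C(m - k, _)]bin_small ?muln0 ?mulr0n ?mulr0 ?mul0r; last by lia.
    move/esym/eqP; rewrite mulf_eq0 signr_eq0 /= => /eqP ->.
    by rewrite mul0rn mulr0 mul0r.
  move=> h.
  have -> : (sextic k)%:R = (-1) ^+ k * (2 ^+ (6 * k) * ('C(m, k) * 'C(m - k, 2 * k))%:R) :> K.
    by rewrite h mulrA -expr2 sqrr_sign mul1r.
  have -> : (m - k - 2 * k = m - 3 * k)%N by lia.
  have -> : d ^+ k = (-1) ^+ k * 2 ^+ (6 * k) * 3 ^+ (3 * k) * x ^+ k.
    rewrite !exprM -!exprMn; congr (_ ^+ k); rewrite /d; ring.
  have -> : 3 ^+ m = 3 ^+ (m - 3 * k) * 3 ^+ (3 * k) :> K by rewrite -exprD subnK.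
  by rewrite natrM -(mulr_natr _ 'C(m, k)) -(mulr_natr _ 'C(m - k, 2 * k)); ring.
rewrite /sextic_poly.
have -> : map_poly intr (\poly_(k < p) (sextic k)%:Z) = \poly_(k < p) (sextic k)%:R :> {poly K}.
  by apply/polyP => i; rewrite coef_map !coef_poly; case: ifP.
rewrite horner_poly mulr_sumr.
under eq_bigr do rewrite -mulrA.
rewrite -!(big_mkord xpredT (fun k => 3 ^+ m * ((sextic k)%:R * x ^+ k))).
rewrite [RHS](@big_cat_nat _ _ _ m.+1) //=; last by lia.
rewrite [X in _ + X]big_nat_cond [X in _ + X]big1 ?addr0 // => k /andP[/andP[k1 k2] _].
have /eqP -> : (sextic k)%:R == 0 :> K; last by rewrite mul0r mulr0.
by rewrite -(dvdn_pcharf pK); apply: dvdn_sextic => //; lia.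
Qed.

(** * Quadratic reciprocity for 33 *)

Lemma legendre_modn (p q : nat) : legendre p%:Z q = legendre (p %% q)%N%:Z q.
Proof.
by rewrite /legendre !dvdzE !absz_nat /dvdn modn_mod -modz_nat modz_mod.
Qed.

(** A Gauss sum t satisfies t^2 = d and t^p = e t with e the quadratic symbol; the
quotient t^(p-1) is then computed in two ways. *)
Lemma half_power_of_sqrt (K : fieldType) (m : nat) (t d e : K) :
  t ^+ 2 = d -> d != 0 -> t ^+ m.*2.+1 = e * t -> d ^+ m = e.
Proof.
move=> <-; rewrite sqrf_eq0 => t0 h; apply: (mulIf t0).
by rewrite -h -exprM mul2n exprSr.
Qed.

(** The Gauss sum is 1 + 2 z for a primitive cube root of unity z. *)
Lemma half_power_neg3 (K : closedFieldType) (p : nat) :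
  p \in [char K] -> (5 <= p)%N -> (-3 : K) ^+ p./2 = (legendre p%:Z 3)%:~R.
Proof.
move=> pK p5; have pp : prime p by case/andP: pK.
have oddp : odd p by case: (even_prime pp) => // h; rewrite h in p5.
have pm : p = p./2.*2.+1 by rewrite -[LHS]odd_double_half oddp.
have [z] : exists z : K, root ('X^2 + 'X + 1) z.
  apply/closed_rootP; rewrite -addrA size_polyDl size_polyXn //.
  by rewrite -polyC1 size_XaddC.
rewrite rootE !hornerE => /eqP hz.
have z2 : z ^+ 2 = - z - 1 by rewrite -[LHS](subr0) -hz; ring.
have z3 : z ^+ 3 = 1 by rewrite exprS z2 mulrBr mulrN -expr2 z2; ring.
apply: (@half_power_of_sqrt K _ (1 + 2 * z)).
- have -> : (1 + 2 * z) ^+ 2 = 1 + 4 * z + 4 * z ^+ 2 by ring.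
  by rewrite z2; ring.
- by rewrite oppr_eq0; apply: (natr_neq0 _ _ _ pK); lia.
rewrite -pm -[LHS](pFrobenius_autE pK) rmorphD rmorph1 rmorphM /= rmorph_nat.
rewrite pFrobenius_autE -(expr_mod _ z3) legendre_modn.
have p3 : ~~ (3 %| p)%N by rewrite dvdn_prime2 //; apply/eqP; lia.
rewrite /dvdn in p3.
have : (p %% 3 < 3)%N by rewrite ltn_mod.
move: p3; case: (p %% 3)%N => [|[|[|]]] // _ _.
  have -> : legendre 1 3 = 1.
    rewrite /legendre /=; case: existsP => // -[].
    by exists (@Ordinal 3 1 isT).
  by ring.
have -> : legendre 2 3 = -1.
  rewrite /legendre /=; case: existsP => // -[[x lx] /=].
  by case: x lx => [|[|[|x]]].
by rewrite z2; ring.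
Qed.

Lemma legendre11 (c : nat) : (0 < c < 11)%N ->
  legendre c%:Z 11 = if c \in [:: 1; 3; 4; 5; 9]%N then 1 else -1.
Proof.
move=> /andP[c0 c11].
have ndvd : (11%:Z %| c%:Z)%Z = false by rewrite dvdzE !absz_nat gtnNdvd.
rewrite /legendre ndvd {ndvd}.
case: existsP => [[[x lx] /= e]|h].
  rewrite ifT //; move: e; rewrite -(modn_small c11).
  by case: c c0 c11 => [|[|[|[|[|[|[|[|[|[|[|c]]]]]]]]]]] // _ _;
    case: x lx => [|[|[|[|[|[|[|[|[|[|[|x]]]]]]]]]]].
rewrite ifF //; apply/negP; rewrite !inE => hc; apply: h.
case/or4P: hc => [/eqP->|/eqP->|/eqP->|/orP[]/eqP->].
- by exists (@Ordinal 11 1 isT).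
- by exists (@Ordinal 11 5 isT).
- by exists (@Ordinal 11 2 isT).
- by exists (@Ordinal 11 4 isT).
- by exists (@Ordinal 11 3 isT).
Qed.

(** The Gauss sum of order 11 is 1 + 2 (z + z^3 + z^4 + z^5 + z^9), the exponents
being the nonzero squares modulo 11.  The Frobenius multiplies these by p,
which fixes the sum or replaces the squares by the nonsquares. *)
Lemma half_power_neg11 (K : closedFieldType) (p : nat) :
  p \in [char K] -> (5 <= p)%N -> p <> 11%N ->
  (-11 : K) ^+ p./2 = (legendre p%:Z 11)%:~R.
Proof.
move=> pK p5 pN11; have pp : prime p by case/andP: pK.
have oddp : odd p by case: (even_prime pp) => // h; rewrite h in p5.
have pm : p = p./2.*2.+1 by rewrite -[LHS]odd_double_half oddp.
have [z] : exists z : K, root (\poly_(i < 11) 1) z.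
  by apply/closed_rootP; rewrite size_poly_eq ?oner_eq0.
rewrite rootE horner_poly !big_ord_recl big_ord0 /= => /eqP hz.
have z10 : z ^+ 10 =
   - (1 + z + z ^+ 2 + z ^+ 3 + z ^+ 4 + z ^+ 5 + z ^+ 6 + z ^+ 7 + z ^+ 8 + z ^+ 9).
  rewrite -[LHS]subr0 -hz /bump /=; ring.
have z11 : z ^+ 11 = 1.
  rewrite exprS z10 (_ : z * _ = - (z + z ^+ 2 + z ^+ 3 + z ^+ 4 + z ^+ 5 + z ^+ 6 + z ^+ 7 + z ^+ 8 + z ^+ 9) - z ^+ 10); last by ring.
  by rewrite z10; ring.
have red n : z ^+ n = z ^+ (n %% 11) by rewrite (expr_mod _ z11).
have red11 n : z ^+ (n + 11) = z ^+ n by rewrite exprD z11 mulr1.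
have n11 : (11 : K) != 0.
  by rewrite -(dvdn_pcharf pK) dvdn_prime2 //; apply/eqP.
apply: (@half_power_of_sqrt K _ (1 + 2 * (z + z ^+ 3 + z ^+ 4 + z ^+ 5 + z ^+ 9))).
(* Exponents above 10 are written n + 11, to be reduced by z^11 = 1. *)
- rewrite (_ : _ ^+ 2 = 1 + 4 * (z + z ^+ 3 + z ^+ 4 + z ^+ 5 + z ^+ 9)
     + 4 * (z ^+ 2 + z ^+ 6 + z ^+ 8 + z ^+ 10 + z ^+ (7 + 11)
       + 2 * (z ^+ 4 + z ^+ 5 + z ^+ 6 + z ^+ 10 + z ^+ 7 + z ^+ 8
              + z ^+ (1 + 11) + z ^+ 9 + z ^+ (2 + 11) + z ^+ (3 + 11)))); last by ring.
  rewrite !red11 z10; ring.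
- by rewrite oppr_eq0.
have frob (a b c d e : K) : (1 + 2 * (a + b + c + d + e)) ^+ p
    = 1 + 2 * (a ^+ p + b ^+ p + c ^+ p + d ^+ p + e ^+ p).
  by rewrite -!(pFrobenius_autE pK) !rmorphD rmorphM !rmorphD !rmorph1.
rewrite -pm frob -!exprM [z ^+ p]red.
rewrite !(mulnC _ p) !(red (p * _)%N) -!(modnMml p) legendre_modn.
have p11 : ~~ (11 %| p)%N by rewrite dvdn_prime2 //; apply/eqP; lia.
rewrite /dvdn in p11.
have : (p %% 11 < 11)%N by rewrite ltn_mod.
move: p11; case: (p %% 11)%N => [|[|[|[|[|[|[|[|[|[|[|c]]]]]]]]]]] // _ _;
  rewrite legendre11 //=; rewrite ?z10; ring.
Qed.

Lemma half_power_33 (K : closedFieldType) (p : nat) :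
  p \in [char K] -> (5 <= p)%N -> p <> 11%N ->
  (33 : K) ^+ p./2 = (jacobi p%:Z 33)%:~R.
Proof.
move=> pK p5 pN11.
have -> : (33 : K) = -3 * -11 by ring.
rewrite exprMn (half_power_neg3 _ _ pK) // (half_power_neg11 _ _ pK) // -rmorphM /=.
rewrite /jacobi (_ : prime_decomp 33 = [:: (3, 1); (11, 1)]%N) //.
by rewrite !big_cons big_nil !expr1 mulr1.
Qed.

(** * Reduction to a divisibility of integers *)

Lemma pintegral_frac (p : nat) (n d : int) : coprimez p%:Z d -> d != 0 ->
  pintegral p (n%:~R / d%:~R).
Proof.
move=> cpd d0; rewrite /pintegral; set x : rat := _ / _.
have e : numq x * d = n * denq x.
  apply: (@intr_inj rat); rewrite !intrM numqE /x; field.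
  by rewrite intr_eq0 d0.
have : (denq x %| d)%Z.
  rewrite -(@Gauss_dvdzr _ (numq x)); first by rewrite e dvdz_mull.
  by rewrite coprimez_sym; exact: coprime_num_den.
by move=> h; apply: coprimez_dvdr h cpd.
Qed.

Lemma eqmod_pint_frac (p d : nat) (n D r : int) : coprimez p%:Z D -> D != 0 ->
  (d%:Z %| n - r * D)%Z -> eqmod_pint p d (n%:~R / D%:~R) r%:~R.
Proof.
move=> cpD D0 /dvdzP[q hq]; split.
- exact: pintegral_frac.
- by rewrite /pintegral denq_int /coprimez gcdz1.
exists (q%:~R / D%:~R); first exact: pintegral_frac.
have D0' : (D%:~R : rat) != 0 by rewrite intr_eq0.
have : (n%:~R : rat) = q%:~R * d%:R + r%:~R * D%:~R.
  by rewrite -[d%:R]/(d%:Z%:~R) -!intrM -intrD -hq subrK.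
by move=> ->; field.
Qed.

(** The numerator of the sum over the common denominator 66^(3(p-1)). *)
Definition clausen_num (p : nat) : int :=
  \sum_(k < p) (clausen k)%:Z * 66 ^+ (3 * (p.-1 - k)).

Lemma binom_sum_frac (p : nat) :
  binom_sum p = (clausen_num p)%:~R / (66 ^+ (3 * p.-1))%:~R.
Proof.
rewrite /binom_sum big_mkord /clausen_num rmorph_sum mulr_suml /=.
apply: eq_bigr => k _; rewrite -mulnA -/(sextic k) -/(clausen k).
have lek : (k <= p.-1)%N by have := ltn_ord k; lia.
rewrite intrM !rmorphXn /= -[in X in _ = _ / X](subnK lek) mulnDr exprD.
have h : (66 : rat) != 0 by [].
have h1 : (66 : rat) ^+ (3 * (p.-1 - k)) != 0 by rewrite expf_neq0.
have h2 : (66 : rat) ^+ (3 * k) != 0 by rewrite expf_neq0.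
rewrite -[66%:~R]/(66 : rat) -[(clausen k)%:~R]/((clausen k)%:R : rat).
by move: (_ ^+ _) (_ ^+ _) h1 h2 => a b ha hb; field; rewrite ha hb.
Qed.

Lemma even_poly_split (R : comNzRingType) (A B : {poly R}) :
  even_poly ((A \Po 'X^2) + (B \Po 'X^2) * 'X) = A.
Proof.
apply/polyP => i; rewrite coef_even_poly coefD coefMX !coef_comp_poly_Xn //.
rewrite -muln2 dvdn_mull // mulnK //.
case: i => [|i] /=; first by rewrite addr0.
by rewrite (_ : (2 %| _)%N = false) ?addr0 //; lia.
Qed.

Lemma comp_poly_shift (R : comNzRingType) (G a b : {poly R}) (e : R) :
  exists c, G \Po (a + e *: b) = (G \Po a) + e *: c.
Proof.
elim/poly_ind: G => [|G x [c hc]]; first by exists 0; rewrite !comp_poly0 scaler0 addr0.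
exists (c * (a + e *: b) + (G \Po a) * b).
rewrite !comp_polyD !comp_polyM !comp_polyX !comp_polyC hc.
by rewrite -!mul_polyC; ring.
Qed.

Lemma exists_inv_mod (p d : nat) : prime p -> ~~ (p %| d)%N ->
  exists i : nat, ((p ^ 2)%:Z %| i%:Z * d%:Z - 1)%Z.
Proof.
move=> pp pd; have c : coprime d (p ^ 2) by rewrite coprimeXr // coprime_sym prime_coprime.
exists (d ^ (totient (p ^ 2)).-1)%N.
have t0 : (0 < totient (p ^ 2))%N by rewrite totient_gt0 expn_gt0 prime_gt0.
rewrite -PoszM mulnC -expnS prednK //.
have /eqP := Euler_exp_totient c.
by rewrite -eqz_mod_dvd !modz_nat => /eqP ->.
Qed.

(** * The two congruences *)

Lemma clausen_pchar (K : fieldType) (p : nat) (x : K) :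
  p \in [char K] -> (5 <= p)%N ->
  (map_poly intr (sextic_poly p)).[x] ^+ 2
    = (map_poly intr (clausen_poly p)).[x * (1 - 432 * x)] :> K.
Proof.
move=> pK p5; have pp : prime p by case/andP: pK.
have [R /(congr1 (fun P => (map_poly (intr : int -> K) P).[x]))] := clausen_mod p pp p5.
rewrite rmorphXn rmorphD /= map_polyZ map_comp_poly /= hornerD hornerZ horner_comp.
rewrite horner_exp => ->.
have -> : ((p ^ 2)%:Z%:~R : K) = 0.
  by apply/eqP; rewrite -(dvdz_pcharf pK) dvdzE !absz_nat -mulnn dvdn_mulr.
rewrite mul0r addr0 /clausen_arg rmorphM rmorphB /= rmorphM rmorph1 /= map_polyX map_polyC.
by rewrite !hornerE.
Qed.

(** With s = y/11, the cubic X^3 - 3 X + 2 (1 - 864 x) at x = i (121 - 21 y) is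
s^3 (Z^3 - 11 Z + 14) with X = s Z.  Here s need not lie in the prime field,
which is why the scaling is performed on coefficients and the character sum
is introduced only afterwards. *)
Lemma sextic_eval (K : fieldType) (p : nat) (iota : {rmorphism 'F_p -> K}) (i y : K) :
  p \in [char K] -> (5 <= p)%N -> p <> 11%N -> y ^+ 2 = 33 -> i * (864 * 121) = 1 ->
  3 ^+ p./2 * (map_poly intr (sextic_poly p)).[i * (121 - 21 * y)]
    = - ((y / 11) ^+ p./2 * (jacobsthal 'F_p (-1))%:~R) :> K.
Proof.
move=> pK p5 pN11 hy hi; have pp : prime p by case/andP: pK.
have oddp : odd p by case: (even_prime pp) => // h; rewrite h in p5.
have cF := card_Fp pp.
have n11 : (11 : K) != 0 by rewrite -(dvdn_pcharf pK) dvdn_prime2 //; apply/eqP.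
have n33 : (33 : K) != 0.
  rewrite -(dvdn_pcharf pK) (_ : 33 = 3 * 11)%N // Euclid_dvdM // !dvdn_prime2 //.
  by apply/norP; split; apply/eqP; lia.
have n121 : (121 : K) != 0 by rewrite (_ : 121 = 11 * 11) ?mulf_neq0 //; ring.
have y0 : y != 0 by apply: contra_neq n33 => y0; rewrite -hy y0 expr0n.
have s0 : y / 11 != 0 by rewrite mulf_neq0 ?invr_eq0.
rewrite -(hasse_sextic _ _ iota) //.
have -> : -3 = (y / 11) ^+ 2 * iota (- 11).
  by rewrite rmorphN rmorph_nat expr_div_n hy; field; rewrite n121.
have -> : 2 - 1728 * (i * (121 - 21 * y)) = (y / 11) ^+ 3 * iota 14.
  rewrite rmorph_nat.
  have hj : 11 / 11 = 1 :> K by rewrite divff.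
  have -> : (y / 11) ^+ 3 = 33 * y / 11 ^+ 3 by rewrite expr_div_n exprSr hy.
  rewrite -exprVn; move: hj; move: (11^-1) => j hj.
  transitivity (1728 * 21 * i * y * (11 * j) ^+ 3).
    rewrite hj (_ : 2 - _ = 2 - 2 * (i * (864 * 121)) + 1728 * 21 * i * y); last by ring.
    by rewrite hi; ring.
  transitivity (33 * y * j ^+ 3 * 14 * (i * (864 * 121))); first by ring.
  by rewrite hi mulr1.
have hm : #|'F_p|.-1./2 = p./2 by rewrite cF; lia.
rewrite hasse_scale // -{2}hm hasse_quadchar ?cF // mulrN; congr (- (_ * _%:~R)).
rewrite -isogeny_sum ?cF //; apply: eq_bigr => x _; congr quadchar; ring.
Qed.

Lemma clausen_num_mod (p : nat) (d w : int) : (d %| 66 ^+ 3 * w - 1)%Z ->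
  (d %| clausen_num p - 66 ^+ (3 * p.-1) * (clausen_poly p).[w])%Z.
Proof.
move=> hd; rewrite /clausen_poly horner_poly mulr_sumr /clausen_num -sumrB.
apply: rpred_sum => k _.
have lek : (k <= p.-1)%N by have := ltn_ord k; lia.
rewrite -[in X in _ - X * _](subnK lek) mulnDr exprD [66 ^+ (3 * k)]exprM.
set c := (clausen k)%:Z; set e := 66 ^+ _; set s := 66 ^+ 3.
rewrite (_ : _ - _ = - (c * e) * ((s * w) ^+ k - 1)); last by rewrite (exprMn _ s w); ring.
by apply: dvdz_mull; rewrite subrX1 dvdz_mulr.
Qed.

Lemma sextic_inv_mod (p : nat) : prime p -> (5 <= p)%N -> p <> 11%N ->
  exists i : nat, ((p ^ 2)%:Z %| i%:Z * (864 * 121)%N%:Z - 1)%Z.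
Proof.
move=> pp p5 pN11; apply: exists_inv_mod => //.
rewrite (_ : 864 = 2 * 2 * 2 * 2 * 2 * 3 * 3 * 3)%N // (_ : 121 = 11 * 11)%N //.
rewrite !Euclid_dvdM // !dvdn_prime2 //.
have [/eqP/negPf -> /eqP/negPf -> /eqP/negPf ->] : [/\ p <> 2, p <> 3 & p <> 11]%N.
  by split => //; lia.
by [].
Qed.

(** 66^3 * 432 * 88 = (864 * 121)^2. *)
Lemma argument_mod (d i : int) : (d %| i * (864 * 121)%N%:Z - 1)%Z ->
  (d %| 66 ^+ 3 * (432 * 88 * i ^+ 2) - 1)%Z.
Proof.
move=> h; rewrite (_ : _ - 1 = (i * (864 * 121)%N%:Z - 1) * (i * (864 * 121)%N%:Z + 1)).
  exact: dvdz_mulr.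
have -> : (864 * 121)%N%:Z = 864 * 121 :> int by rewrite PoszM.
ring.
Qed.

Lemma closure_pchar (p : nat) : prime p ->
  exists (K : closedFieldType) (iota : {rmorphism 'F_p -> K}), p \in [char K].
Proof.
move=> pp; have [K [iota _]] := countable_algebraic_closure 'F_p.
by exists K, iota; apply: rmorph_pchar iota _ (pchar_Fp pp).
Qed.

Lemma fermat_pchar (K : fieldType) (p : nat) (iota : {rmorphism 'F_p -> K}) (z : int) :
  prime p -> z%:~R != 0 :> K -> z%:~R ^+ p.-1 = 1 :> K.
Proof.
move=> pp z0; have := expf_card1 'F_p z%:~R; rewrite card_Fp // => h.
rewrite -(rmorph_int iota) -rmorphXn /= h ?rmorph1 //.
by apply: contra_neq z0 => z0; rewrite -(rmorph_int iota) z0 rmorph0.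
Qed.

Lemma sqrt_closed (K : closedFieldType) (c : K) : exists y : K, y ^+ 2 = c.
Proof.
have [y] : exists y, root ('X^2 - c%:P) y.
  by apply/closed_rootP; rewrite size_XnsubC.
by rewrite rootE !hornerE subr_eq0 => /eqP; exists y.
Qed.

Lemma intr_inv_mod (K : fieldType) (p : nat) (i : int) : p \in [char K] ->
  ((p ^ 2)%:Z %| i * (864 * 121)%N%:Z - 1)%Z -> i%:~R * (864 * 121) = 1 :> K.
Proof.
move=> pK h; apply/eqP; rewrite -subr_eq0.
have -> : i%:~R * (864 * 121) - 1 = (i * (864 * 121)%N%:Z - 1)%:~R :> K.
  by rewrite intrB intrM PoszM intrM.
rewrite -(dvdz_pcharf pK); apply: dvdz_trans h.
by rewrite dvdzE !absz_nat -mulnn dvdn_mulr.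
Qed.

(** The value does not involve y: the argument of the 3F2 series is rational
although that of the 2F1 series lies in a quadratic extension. *)
Lemma clausen_arg_eval (K : fieldType) (i y : K) : y ^+ 2 = 33 -> i * (864 * 121) = 1 ->
  i * (121 - 21 * y) * (1 - 432 * (i * (121 - 21 * y))) = 432 * 88 * i ^+ 2.
Proof.
move=> hy hi.
transitivity (i * (121 - 21 * y) * (i * (864 * 121) - 432 * (i * (121 - 21 * y)))).
  by rewrite hi.
transitivity (432 * i ^+ 2 * (121 ^+ 2 - 441 * y ^+ 2)); first by ring.
by rewrite hy; ring.
Qed.

Lemma clausen_num_modp (p : nat) (a b : int) : prime p -> (5 <= p)%N -> p <> 11%N ->
  (p = 1 %[mod 4])%N -> p%:Z = a ^+ 2 + b ^+ 2 -> ~~ (2 %| a)%Z ->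
  (p%:Z %| clausen_num p - jacobi p%:Z 33 * (4 * a ^+ 2) * 66 ^+ (3 * p.-1))%Z.
Proof.
move=> pp p5 pN11 p1 hab oa.
have oddp : odd p by lia.
have [K [iota pK]] := closure_pchar p pp.
have [y hy] := sqrt_closed K 33.
have [i hi] := sextic_inv_mod p pp p5 pN11.
have hiK := intr_inv_mod K p i pK hi.
have cF := card_Fp pp.
have nz (z : int) : ~~ (p%:Z %| z)%Z -> z%:~R != 0 :> K by rewrite (dvdz_pcharf pK).
have n66 : (66 : K) ^+ (3 * p.-1) = 1.
  rewrite mulnC exprM (fermat_pchar K p iota 66) ?expr1n //; apply: nz.
  rewrite dvdzE absz_nat (_ : `|66|%N = 2 * 3 * 11)%N // !Euclid_dvdM // !dvdn_prime2 //.
  by apply/negP => /orP[/orP[]|] /eqP; lia.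
have n3 : (3 : K) ^+ p.-1 = 1.
  apply: (fermat_pchar K p iota 3) => //; apply: nz.
  by rewrite dvdzE absz_nat dvdn_prime2 //; apply/eqP; lia.
have n11 : (11 : K) ^+ p.-1 = 1.
  apply: (fermat_pchar K p iota 11) => //; apply: nz.
  by rewrite dvdzE absz_nat dvdn_prime2 //; apply/eqP; lia.
have m2 : p.-1 = (p./2 * 2)%N by lia.
have val := sextic_eval K p iota i%:~R y pK p5 pN11 hy hiK.
have F1 : (#|'F_p| = 1 %[mod 4])%N by rewrite cF.
have [u [v [hu ou huv]]] := jacobsthal_two_squares 'F_p F1.
rewrite cF in huv.
have au := prime_two_squares_uniq p a b u v pp oddp hab huv oa ou.
have hp : (p%:Z %| (p ^ 2)%:Z)%Z by rewrite dvdzE !absz_nat -mulnn dvdn_mulr.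
have := clausen_num_mod p p _ (argument_mod p i (dvdz_trans hp hi)).
rewrite !(dvdz_pcharf pK) !intrB !subr_eq0 => /eqP ->.
rewrite !intrM !rmorphXn /= -[66%:~R]/(66 : K) n66 mul1r mulr1 -horner_map /=.
set w := (X in _.[X]).
have -> : w = 432 * 88 * i%:~R ^+ 2 by rewrite /w intrM rmorphXn intrM.
rewrite -(clausen_arg_eval K _ y hy hiK) -clausen_pchar //.
have := congr1 (fun z => z ^+ 2) val.
rewrite exprMn -exprM -m2 n3 mul1r sqrrN => ->.
rewrite exprMn -exprM mulnC exprM expr_div_n hy expr_div_n -exprM mulnC -m2 n11 divr1.
have auK : a%:~R ^+ 2 = u%:~R ^+ 2 :> K by rewrite -!rmorphXn /= au.
rewrite (half_power_33 K p pK p5 pN11) hu intrM exprMn -[2%:~R]/(2 : K).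
rewrite -[a%:~R * _]expr2 auK -[4%:~R]/(4 : K).
by apply/eqP; ring.
Qed.

(** The integer polynomial P is f composed with an integral model of
(121 - 21 X) / (121 * 864) modulo p^2; its even and odd parts at X^2 = 33 are
the coordinates e and o of f(x) on the basis 1, sqrt 33.  Taking the even
part of the identity of Clausen for P^2 gives the sum as e^2 + 33 o^2. *)
Lemma clausen_num_modp2 (p : nat) : prime p -> (5 <= p)%N -> p <> 11%N ->
  (p = 3 %[mod 4])%N -> ((p ^ 2)%:Z %| clausen_num p)%Z.
Proof.
move=> pp p5 pN11 p3.
have oddp : odd p by lia.
have [K [iota pK]] := closure_pchar p pp.
have [y hy] := sqrt_closed K 33.
have [i hi] := sextic_inv_mod p pp p5 pN11.
have hiK := intr_inv_mod K p i pK hi.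
have cF := card_Fp pp.
have J0 : jacobsthal 'F_p (-1) = 0.
  apply: jacobsthal_odd; rewrite ?cF // quadchar_opp1 ?cF //.
  by rewrite -signr_odd (_ : odd p.-1./2 = true) //; lia.
have nz (z : int) : ~~ (p%:Z %| z)%Z -> z%:~R != 0 :> K by rewrite (dvdz_pcharf pK).
have n33 : (33 : K) != 0.
  apply: (nz 33); rewrite dvdzE absz_nat (_ : `|33|%N = 3 * 11)%N //.
  by rewrite !Euclid_dvdM // !dvdn_prime2 //; apply/negP => /orP[] /eqP; lia.
have n3 : (3 : K) != 0.
  by apply: (nz 3); rewrite dvdzE absz_nat dvdn_prime2 //; apply/eqP; lia.
have n2 : (2 : K) != 0.
  by apply: (nz 2); rewrite dvdzE absz_nat dvdn_prime2 //; apply/eqP; lia.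
have y0 : y != 0 by apply: contra_neq n33 => y0; rewrite -hy y0 expr0n.
have zero (t : K) : t ^+ 2 = 33 ->
    (map_poly intr (sextic_poly p)).[i%:~R * (121 - 21 * t)] = 0.
  move=> ht; apply: (mulfI (expf_neq0 p./2 n3)).
  by rewrite (sextic_eval K p iota i%:~R t pK p5 pN11 ht hiK) J0 !mulr0 oppr0.
pose x : {poly int} := i%:Z%:P * (121%:P - 21%:P * 'X).
pose P := sextic_poly p \Po x.
pose e := (even_poly P).[33]; pose o := (odd_poly P).[33].
have val (t : K) : t ^+ 2 = 33 -> e%:~R + o%:~R * t = 0.
  move=> ht; rewrite -[RHS](zero t ht).
  have -> : i%:~R * (121 - 21 * t) = (map_poly intr x).[t].
    by rewrite /x rmorphM rmorphB rmorphM /= !map_polyC map_polyX !hornerE.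
  rewrite -horner_comp -map_comp_poly -/P -[P in RHS]poly_even_odd.
  rewrite rmorphD rmorphM /= !map_comp_poly rmorphXn /= map_polyX !hornerE.
  by rewrite !horner_comp hornerXn ht -[33]/(33%:~R) !horner_map.
have h1 := val y hy; have h2 := val (- y); rewrite sqrrN in h2; move: h2 => /(_ hy) h2.
have pe : (p%:Z %| e)%Z.
  rewrite (dvdz_pcharf pK); apply/eqP; apply: (mulfI n2); rewrite mulr0.
  by rewrite -[RHS](addr0 0) -{1}h1 -h2; ring.
have po : (p%:Z %| o)%Z.
  rewrite (dvdz_pcharf pK); apply/eqP; apply: (mulIf y0); rewrite mul0r.
  by rewrite -[RHS]h1; move: pe; rewrite (dvdz_pcharf pK) => /eqP ->; rewrite add0r.
have [R hR] := clausen_mod p pp p5.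
(* With i D = 1 + p^2 j and D = 864 * 121, the argument of G is even in X only
   up to a multiple of p^2. *)
have /dvdzP[j hj] := hi.
pose h : {poly int} := 432%:P * (i%:Z ^+ 2)%:P * ((121 ^+ 2)%:P - 441%:P * 'X).
have hx : clausen_arg \Po x = (h \Po 'X^2) + (p ^ 2)%:Z *: (- j%:P * x).
  rewrite /clausen_arg comp_polyM comp_polyB comp_polyM !comp_polyC comp_polyX polyC1.
  have -> : 1 - 432%:P * x = (i%:Z * (864 * 121) - j * (p ^ 2)%:Z)%:P - 432%:P * x.
    congr (_ - _); rewrite -polyC1; congr polyC.
    by rewrite -hj PoszM; ring.
  rewrite /h !comp_polyM !comp_polyC comp_polyB comp_polyM !comp_polyC comp_polyX.
  by rewrite /x -mul_polyC polyCB !polyCM; ring.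
have [c hc] := comp_poly_shift _ (clausen_poly p) (h \Po 'X^2) (- j%:P * x) (p ^ 2)%:Z.
have hP : P ^+ 2 = ((clausen_poly p \Po h) \Po 'X^2) + (p ^ 2)%:Z *: (c + (R \Po x)).
  rewrite /P -rmorphXn /= hR comp_polyD -comp_polyA hx hc comp_polyZ comp_polyA.
  by rewrite scalerDr addrA.
have sq : even_poly (P ^+ 2) = even_poly P ^+ 2 + 'X * odd_poly P ^+ 2.
  rewrite -[X in X ^+ 2]poly_even_odd.
  set E := even_poly P; set O := odd_poly P.
  rewrite (_ : _ ^+ 2 = ((E ^+ 2 + 'X * O ^+ 2) \Po 'X^2) + ((2%:P * E * O) \Po 'X^2) * 'X).
    exact: even_poly_split.
  rewrite comp_polyD !comp_polyM comp_polyX comp_polyC.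
  by ring.
have ev : e ^+ 2 + 33 * o ^+ 2 =
   (clausen_poly p).[432 * 88 * i%:Z ^+ 2] + (p ^ 2)%:Z * (even_poly (c + (R \Po x))).[33].
  have := congr1 (fun P => (even_poly P).[33]) hP.
  rewrite sq even_polyD even_polyZ.
  rewrite -[X in even_poly X + _]addr0 -(mul0r 'X) -(comp_poly0 'X^2) even_poly_split.
  rewrite !hornerE horner_comp => ->; congr (_.[_] + _).
  by rewrite /h !hornerE; ring.
have d2 : ((p ^ 2)%:Z %| (clausen_poly p).[432 * 88 * i%:Z ^+ 2])%Z.
  have -> : (clausen_poly p).[432 * 88 * i%:Z ^+ 2] = e ^+ 2 + 33 * o ^+ 2 -
     (p ^ 2)%:Z * (even_poly (c + (R \Po x))).[33] by rewrite ev addrK.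
  have sqd (z : int) : (p%:Z %| z)%Z -> ((p ^ 2)%:Z %| z ^+ 2)%Z.
    by move=> /dvdzP[q ->]; apply/dvdzP; exists (q ^+ 2); rewrite exprMn -mulnn PoszM.
  by rewrite rpredB ?dvdz_mulr // rpredD ?sqd // dvdz_mull ?sqd.
have := clausen_num_mod p _ _ (argument_mod _ i hi).
move=> hN; rewrite -[clausen_num p](subrK (66 ^+ (3 * p.-1) * (clausen_poly p).[432 * 88 * i%:Z ^+ 2])).
by rewrite rpredD // dvdz_mull.
Qed.

Theorem theorem4p10 (p : nat) (p_prime : prime p)
    (p_neq2 : p <> 2%N) (p_neq3 : p <> 3%N) (p_neq11 : p <> 11%N) :
  ((p = 3 %[mod 4])%N -> eqmod_pint p (p ^ 2)%N (binom_sum p) 0) /\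
  ((p = 1 %[mod 4])%N ->
   forall a b : int, p%:Z = a ^+ 2 + b ^+ 2 -> ~~ (2 %| a)%Z ->
   eqmod_pint p p (binom_sum p) ((jacobi p%:Z 33 * (4 * a ^+ 2))%:~R)).
Proof.
have p5 : (5 <= p)%N.
  by case: (p) p_prime p_neq2 p_neq3 => [|[|[|[|[|q]]]]].
have cop : coprimez p%:Z (66 ^+ (3 * p.-1)).
  apply: coprimezXr; rewrite coprimezE absz_nat (_ : `|66|%N = 2 * 3 * 11)%N //.
  rewrite prime_coprime // !Euclid_dvdM // !dvdn_prime2 //.
  by apply/negP => /orP[/orP[]|] /eqP; lia.
have nz : 66 ^+ (3 * p.-1) != 0 :> int by rewrite expf_neq0.
rewrite binom_sum_frac; split=> [p3 | p1 a b hab oa].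
  have := @eqmod_pint_frac p (p ^ 2) (clausen_num p) _ 0 cop nz.
  by rewrite mul0r subr0; apply; apply: clausen_num_modp2.
apply: eqmod_pint_frac => //.
exact: (clausen_num_modp p a b).
Qed.
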